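(* Let $h$ and $s$ be nearly flat functions and $v_s\in\mathbb{R}$ a constant; let $H=\mathcal{R}(h,0)$ be the hypothesis region and $S=\mathcal{R}(s,v_s)^c$ the selective region. Suppose that $E_{-1}h$ exists and is nearly flat. Suppose also that the functional forms of $\psi_{\sigma^2}(H|y)$ and $\psi_{\sigma^2}(S|y)$ can be extrapolated to $\sigma^2=-1$ and $\sigma^2=0$, respectively. Define the selective $p$-value $$p_{\mathrm{SI}}(H|S,y)=\frac{\bar\Phi(\psi_{-1}(H|y))}{\bar\Phi(\psi_{-1}(H|y)+\psi_0(S|y))}.$$ For a given significance level $0<\alpha<1$, set $R=\{y\in\mathbb{R}^{m+1}\mid p_{\mathrm{SI}}(H|S,y)<\alpha\}$. Then $R$ is equivalent, erring only $O(\lambda^2)$, to the region $\mathcal{R}(r,v_r)^c$ with $v_r=\bar\Phi^{-1}(\alpha\bar\Phi(v_s))$, $C=\phi(v_s)/\phi(v_r)$ and $r(u)\simeq E_{-1}h(u)+\alpha C\{s(u)-E_{-1}h(u)\}$, and thus $R$ satisfies $$\frac{P_1(Y\in R\mid\mu)}{P_1(Y\in S\mid\mu)}\simeq\alpha,\qquad\forall\mu\in\partial H.$$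
   Context: Theory of nearly flat surfaces. $m\ge0$ is fixed and $\lambda\to0$ is an artificial parameter on which functions may depend; $\simeq$ denotes equality up to an error of order $O(\lambda^2)$. Points of $\mathbb{R}^{m+1}$ are written $y=(u,v)$, $u\in\mathbb{R}^m$, $v\in\mathbb{R}$. $\phi$ and $\bar\Phi=1-\Phi$ are the density and upper tail probability of $N(0,1)$. $P_{\sigma^2}(\cdot\mid y)$ is the probability with respect to $N_{m+1}(y,\sigma^2I_{m+1})$; in particular $P_1(\cdot\mid\mu)$ refers to $Y\sim N_{m+1}(\mu,I_{m+1})$. For continuous $h:\mathbb{R}^m\to\mathbb{R}$ and $v_h\in\mathbb{R}$, $\mathcal{R}(h,v_h)=\{(u,v)\in\mathbb{R}^{m+1}\mid v\le v_h-h(u)\}$. A continuous $h$ is nearly flat if $\|h\|_\infty=\sup_u|h(u)|=O(\lambda)$, $\|h\|_1=\int|h(u)|\,du<\infty$ and $\|\tilde h\|_1<\infty$, where $\tilde h(\omega)=\mathcal{F}h(\omega)=\int_{\mathbb{R}^m}e^{-i\omega\cdot u}h(u)\,du$. For $\sigma^2\in\mathbb{R}$, $E_{\sigma^2}h(u)=\mathcal{F}^{-1}[e^{-\sigma^2\|\omega\|^2/2}\tilde h(\omega)](u)$, with $\mathcal{F}^{-1}$ the inverse Fourier transform $(2\pi)^{-m}\int e^{i\omega\cdot u}(\cdot)\,d\omega$. For $\sigma^2\ge 0$ this is $E[h(U^* )]$ with $U^*\sim N_m(u,\sigma^2I_m)$; $E_{-1}h$ exists if $\|e^{\|\omega\|^2/2}\tilde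 h(\omega)\|_1<\infty$. For $\sigma^2>0$ and a region $D$, $\alpha_{\sigma^2}(D|y)=P_{\sigma^2}(Y^*\in D\mid y)$ and $\psi_{\sigma^2}(D|y)=\sigma\bar\Phi^{-1}(\alpha_{\sigma^2}(D|y))$. For nearly flat $h,s$ it is known that, for $y=(u,v)$ and $\sigma^2>0$, $\psi_{\sigma^2}(\mathcal{R}(h,0)|y)\simeq v+E_{\sigma^2}h(u)$ and $\psi_{\sigma^2}(\mathcal{R}(s,v_s)^c|y)=-\psi_{\sigma^2}(\mathcal{R}(s,v_s)|y)\simeq -v+v_s-E_{\sigma^2}s(u)$. Extrapolating the functional forms to $\sigma^2=-1$ (for $H$) and $\sigma^2=0$ (for $S$) means that $\psi_{-1}(H|y)$ and $\psi_0(S|y)$ denote the values of these functional forms in $\sigma^2$ at $\sigma^2=-1$ and $\sigma^2=0$, i.e. $\psi_{-1}(H|y)\simeq v+E_{-1}h(u)$ and $\psi_0(S|y)\simeq -v+v_s-s(u)$. *)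

(* Defs.v *)
From HB Require Import structures.
From mathcomp Require Import all_boot all_order all_algebra.
From mathcomp Require Import all_classical all_reals all_analysis.
From mathcomp Require Import complex.

Set Implicit Arguments.
Unset Strict Implicit.
Unset Printing Implicit Defensive.

Import Order.TTheory GRing.Theory Num.Theory.
Import numFieldNormedType.Exports.

Local Open Scope classical_set_scope.
Local Open Scope ring_scope.

(* The product sigma-algebra on row vectors, built like the one the library
   puts on n.-tuple T. *)
Section measurable_rV.
Context {d} {T : sigmaRingType d} (n : nat).

Let coord (i : 'I_n) (u : 'rV[T]_n) : T := u ord0 i.

Let rV_set0 : g_sigma_preimage coord set0.
Proof. exact: sigma_algebra0. Qed.

Let rV_setC A : g_sigma_preimage coord A -> g_sigma_preimage coord (~` A).
Proof. exact: sigma_algebraC. Qed.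

Let rV_bigcup (F : (set 'rV[T]_n)^nat) :
  (forall i, g_sigma_preimage coord (F i)) ->
  g_sigma_preimage coord (\bigcup_i (F i)).
Proof. exact: sigma_algebra_bigcup. Qed.

HB.instance Definition _ := @isMeasurable.Build (measure_tuple_display d)
  'rV[T]_n (g_sigma_preimage coord) rV_set0 rV_setC rV_bigcup.

End measurable_rV.

Section measurable_rV_theory.
Context {d d'} {T : sigmaRingType d} {U : measurableType d'}.

Lemma measurable_coord_rV n (i : 'I_n) :
  measurable_fun [set: 'rV[T]_n] (fun u : 'rV[T]_n => u ord0 i).
Proof.
move=> _ A mA; rewrite setTI; apply: sub_sigma_algebra => /=.
rewrite -bigcup_seq/=; exists i => /=; first by rewrite mem_index_enum.
by exists A => //; rewrite setTI.
Qed.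

Lemma measurable_fun_rV n (f : U -> 'rV[T]_n) :
  (forall i, measurable_fun setT (fun x => f x ord0 i)) ->
  measurable_fun setT f.
Proof.
move=> mf _ A mA; rewrite setTI.
have : preimage_set_system setT f
    (g_sigma_preimage (fun (i : 'I_n) (u : 'rV[T]_n) => u ord0 i)) (f @^-1` A).
  by exists A => //; rewrite setTI.
rewrite -g_sigma_preimage_comp; apply.
split; first exact: sigma_algebra_measurable.
by rewrite -bigcup_seq; apply: bigcup_sub => i _ _ [B mB <-]; exact: mf.
Qed.

End measurable_rV_theory.

(* Lebesgue measure on 'rV[R]_n: the image of the product of Lebesgue measures
   on R * 'rV[R]_n by (x, u) |-> (x, u_0, ..., u_{n-1}), starting from the
   unit mass on the one-point space 'rV[R]_0. *)
Section lebesgue_rV.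
Context {R : realType}.

Definition cons_rV n (z : R * 'rV[R]_n) : 'rV[R]_n.+1 :=
  \row_i (if unlift ord0 i is Some j then z.2 ord0 j else z.1).

Definition uncons_rV n (u : 'rV[R]_n.+1) : R * 'rV[R]_n :=
  (u ord0 ord0, \row_j u ord0 (lift ord0 j)).

Lemma cons_rVK n : cancel (@cons_rV n) (@uncons_rV n).
Proof.
move=> [x u]; rewrite /uncons_rV /cons_rV !mxE unlift_none; congr pair.
by apply/rowP => j; rewrite !mxE liftK.
Qed.

Lemma measurable_cons_rV n : measurable_fun setT (@cons_rV n).
Proof.
apply: measurable_fun_rV => i.
under eq_fun do rewrite mxE; case: (unlift ord0 i) => [j|]; last exact: measurable_fst.
exact: (measurableT_comp (measurable_coord_rV j)) measurable_snd.
Qed.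

Lemma measurable_uncons_rV n : measurable_fun setT (@uncons_rV n).
Proof.
apply/measurable_fun_pair => /=; first exact: measurable_coord_rV.
apply: measurable_fun_rV => i; under eq_fun do rewrite mxE.
exact: measurable_coord_rV.
Qed.

Section step.
Variables (n : nat) (mu : {sigma_finite_measure set 'rV[R]_n -> \bar R}).

Definition lebesgue_cons : set 'rV[R]_n.+1 -> \bar R :=
  pushforward (lebesgue_measure \x mu)%E (@cons_rV n).

Let measurable_preimage_cons A :
  measurable A -> measurable (@cons_rV n @^-1` A).
Proof.
by move=> mA; rewrite -[X in measurable X]setTI; exact: measurable_cons_rV.
Qed.

Let lebesgue_cons0 : lebesgue_cons set0 = 0%E.
Proof. by rewrite /lebesgue_cons /pushforward preimage_set0 measure0. Qed.

Let lebesgue_cons_ge0 A : (0 <= lebesgue_cons A)%E.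
Proof. by rewrite /lebesgue_cons /pushforward measure_ge0. Qed.

Let lebesgue_cons_sigma_additive : semi_sigma_additive lebesgue_cons.
Proof.
move=> F mF tF mUF; rewrite /lebesgue_cons /pushforward preimage_bigcup.
apply: measure_semi_sigma_additive.
- by move=> k; exact: measurable_preimage_cons.
- apply/trivIsetP => /= i j _ _ ij; rewrite -preimage_setI.
  by move/trivIsetP : tF => /(_ _ _ _ _ ij) ->//; rewrite preimage_set0.
- by rewrite -preimage_bigcup; exact: measurable_preimage_cons.
Qed.

HB.instance Definition _ := isMeasure.Build _ _ _ lebesgue_cons
  lebesgue_cons0 lebesgue_cons_ge0 lebesgue_cons_sigma_additive.

Let lebesgue_cons_sigma_finite : sigma_finite setT lebesgue_cons.
Proof.
have /sigma_finiteP[F [TF ndF Foo]] := sigma_finiteT (@lebesgue_measure R).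
have /sigma_finiteP[G [TG ndG Goo]] := sigma_finiteT mu.
exists (fun k => @uncons_rV n @^-1` (F k `*` G k)).
  rewrite -preimage_bigcup (_ : \bigcup_k _ = setT) ?preimage_setT//.
  rewrite -setXTT TF TG predeqE => -[x y]; split.
    by move=> [k _ []/= ? ?]; split; exists k.
  move=> [/= [k _ Fkx] [l _ Gly]]; exists (maxn k l) => //; split.
  - by move: x Fkx; exact/subsetPset/ndF/leq_maxl.
  - by move: y Gly; exact/subsetPset/ndG/leq_maxr.
move=> k; have [mF Fk] := Foo k; have [mG Gk] := Goo k; split.
  rewrite -[X in measurable X]setTI; apply: measurable_uncons_rV => //.
  exact: measurableX.
rewrite /lebesgue_cons /pushforward -comp_preimage.
rewrite (_ : _ \o _ = id); last by apply/funext => z /=; rewrite cons_rVK.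
by rewrite preimage_id product_measure1E// lte_mul_pinfty// ge0_fin_numE.
Qed.

HB.instance Definition _ := Measure_isSigmaFinite.Build _ _ _ lebesgue_cons
  lebesgue_cons_sigma_finite.

End step.

Fixpoint lebesgue_rV n : {sigma_finite_measure set 'rV[R]_n -> \bar R} :=
  if n is k.+1 then lebesgue_cons (lebesgue_rV k) else \d_(0 : 'rV[R]_0).

End lebesgue_rV.

Section fourier.
Context {R : realType} {m : nat}.
Local Open Scope complex_scope.
Implicit Types (h : 'rV[R]_m -> R) (g : 'rV[R]_m -> R[i]) (u w : 'rV[R]_m).

Definition dot w u : R := \sum_(i < m) w ord0 i * u ord0 i.

Definition cintegral g : R[i] :=
  (\int[lebesgue_rV m]_u complex.Re (g u))
    +i* (\int[lebesgue_rV m]_u complex.Im (g u)).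

Definition expi (t : R) : R[i] := cos t +i* sin t.

Definition fourier h w : R[i] :=
  cintegral (fun u => expi (- dot w u) * (h u)%:C).

Definition inv_fourier g u : R[i] :=
  (((2 * pi) ^+ m)^-1)%:C * cintegral (fun w => expi (dot w u) * g w).

Definition finite_L1 g : Prop :=
  (\int[lebesgue_rV m]_u (ComplexField.Normc.normc (g u))%:E < +oo)%E.

(* The Fourier multiplier e^(- sigma2 |w|^2 / 2) applied to h~; sigma2 may be
   negative. *)
Definition spread_hat (sigma2 : R) h w : R[i] :=
  (expR (- (sigma2 * dot w w / 2)))%:C * fourier h w.

(* E_sigma2 h.  The inverse transform is real since h is, so taking the real
   part only changes its type. *)
Definition spread (sigma2 : R) h u : R :=
  complex.Re (inv_fourier (spread_hat sigma2 h) u).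

Definition spread_exists (sigma2 : R) h : Prop :=
  finite_L1 (spread_hat sigma2 h).

(* Families are indexed by the parameter l -> 0 (lambda). *)
Definition nearly_flat (h : R -> 'rV[R]_m -> R) : Prop :=
  [/\ \forall l \near 0^', continuous (h l),
      exists K : R, \forall l \near 0^', forall u, `|h l u| <= K * `|l|,
      \forall l \near 0^', finite_L1 (fun u => (h l u)%:C) &
      \forall l \near 0^', finite_L1 (fourier (h l))].

End fourier.

Section normal_tail.
Context {R : realType}.

Definition phi (x : R) : R := normal_pdf 0 1 x.

Definition Phibar (x : R) : R := fine (normal_prob 0 1 `]x, +oo[).

(* Only meaningful for 0 < p < 1, where the preimage of p is a singleton. *)
Definition Phibar_inv (p : R) : R := xget 0 [set x | Phibar x = p].

End normal_tail.

Section regions.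
Context {R : realType} {m : nat}.
Local Notation point := ('rV[R]_m * R)%type.
Implicit Types (y mu : point) (D : set point).

Definition region (h : 'rV[R]_m -> R) (vh : R) : set point :=
  [set y | y.2 <= vh - h y.1].

Definition boundary D : set point := closure D `\` interior D.

(* Density of N_{m+1}(y, sigma^2 I). *)
Definition gauss_pdf (sigma : R) y (z : point) : R :=
  (\prod_(i < m) normal_pdf (y.1 ord0 i) sigma (z.1 ord0 i))
  * normal_pdf y.2 sigma z.2.

(* P_sigma2 (Y in D | y) *)
Definition gauss_prob (sigma2 : R) D y : R :=
  \int[(lebesgue_rV m \x lebesgue_measure)%E]_(z in D)
    gauss_pdf (Num.sqrt sigma2) y z.

Definition psi (sigma2 : R) D y : R :=
  Num.sqrt sigma2 * Phibar_inv (gauss_prob sigma2 D y).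

(* Equality up to O(l^2) of families of functions of u, uniformly in u. *)
Definition approx_u (f g : R -> 'rV[R]_m -> R) : Prop :=
  exists K : R, \forall l \near 0^', forall u, `|f l u - g l u| <= K * l ^+ 2.

(* Equality up to O(l^2) of families of functions of y = (u, v), uniformly in
   u and locally uniformly in v.  The linear growth in v cannot be dropped:
   for nearly flat h, psi_sigma2(R(h, 0)|y) differs from v + E_sigma2 h(u) by a
   term of order |v| l^2. *)
Definition approx_y (f g : R -> point -> R) : Prop :=
  exists K : R, \forall l \near 0^', forall y,
    `|f l y - g l y| <= K * (1 + `|y.2|) * l ^+ 2.

(* F sigma2 is a functional form, in sigma2, of psi_sigma2(D|y), and psi0 is
   psi_{sigma0}(D|y), the value of that form extrapolated to sigma0. *)
Definition extrapolates (D : R -> set point) (F : R -> R -> point -> R)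
    (sigma0 : R) (psi0 : R -> point -> R) : Prop :=
  (forall sigma2 : R, 0 < sigma2 ->
     approx_y (fun l => psi sigma2 (D l)) (F sigma2))
  /\ approx_y psi0 (F sigma0).

(* A and B, the latter of the form v > f(u), are equal up to moving the
   boundary of B by O(l^2) in the direction of v, uniformly in u. *)
Definition approx_region (A B : R -> set point) : Prop :=
  exists K : R, \forall l \near 0^', forall u v,
    (B l (u, v - K * l ^+ 2) -> A l (u, v))
    /\ (A l (u, v) -> B l (u, v + K * l ^+ 2)).

Definition pSI (psiH psiS : point -> R) y : R :=
  Phibar (psiH y) / Phibar (psiH y + psiS y).

End regions.

(* Main.v *)
(* Fourier inversion gives E_0 s = s, and since E_1 multiplies the transform by
   e^(-|w|^2/2), which E_{-1} undoes, a Gaussian average of E_{-1} h over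
   N(u, I) is h(u).  Write e = E_{-1} h and b = alpha C; the defining relations
   Phibar(vr) = alpha Phibar(vs) and phi(vr) b = alpha phi(vs) say that
   Phibar(vr + b x) and alpha Phibar(vs + x) agree to first order at x = 0.
   Hence pSI < alpha holds for v > vr - r(u) + O(l^2) and fails for
   v <= vr - r(u) - O(l^2), with r = e + b (s - e): this is a Taylor expansion
   while v stays bounded; for large v it follows from the superexponential decay
   of Phibar, and for very negative v the numerator of pSI is close to 1.
   At mu = (u, -h(u)) on the boundary of H, the probability of {v > c - f(u)} is
   Phibar(c) + phi(c) (E_1 f(u) - h(u)) + O(l^2).  Enclosing the rejection region
   between two such sets, with E_1 r(u) = h(u) + b (E_1 s(u) - h(u)), gives
   alpha (Phibar(vs) + phi(vs) (E_1 s(u) - h(u))) + O(l^2), which is alpha times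
   the probability of S. *)
Require Import Defs.
From mathcomp Require Import all_boot all_order all_algebra.
From mathcomp Require Import all_classical all_reals all_analysis.
From mathcomp Require Import measurable_realfun complex ring lra.
Import Order.TTheory GRing.Theory Num.Theory.
Import numFieldNormedType.Exports.
Local Open Scope classical_set_scope.
Local Open Scope ring_scope.

Set Implicit Arguments.
Unset Strict Implicit.
Unset Printing Implicit Defensive.

(** * Gaussian integrals on row vectors *)

(** The multiplier of E_{-1} grows like e^(|w|^2/2), so E_{-1} h is only an inverse transform, with
    no averaging formula to start from. Every Fourier step therefore goes through one explicit
    integral, the mean of a cosine wave under a Gaussian, combined with Fubini. For E_0 s = s,
    damping by e^(-c^2 |w|^2/2) turns the inverse transform into the average of s over N(u, c^2 I),
    and c is then sent to 0 on both sides. For h, the wave expansion of E_{-1} h is averaged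
    frequency by frequency. Transforms are split into cosine and sine parts, so all integrals are
    real. The other obstacle is that psi_{-1} and psi_0 are arbitrary functions within O(l^2) of
    their forms, so the rejection region may fail to be measurable. It enters the probability
    estimate only through inclusions between measurable sets, with [gauss_prob] monotone on all
    sets. *)

Section dominated_Fubini.
Context d1 d2 (T1 : measurableType d1) (T2 : measurableType d2) (R : realType).
Variables (m1 : {sigma_finite_measure set T1 -> \bar R})
  (m2 : {sigma_finite_measure set T2 -> \bar R}).
Variables (f : T1 * T2 -> R) (g1 : T1 -> R) (g2 : T2 -> R).
Hypotheses (mf : measurable_fun setT f)
  (ig1 : m1.-integrable setT (EFin \o g1))
  (ig2 : m2.-integrable setT (EFin \o g2))
  (fg : forall x y, `|f (x, y)| <= g1 x * g2 y).

Lemma dominated_integrable_pair1 x :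
  m2.-integrable setT (fun y => (f (x, y))%:E).
Proof.
apply: (@le_integrable _ _ _ _ _ measurableT _ (fun y => (g1 x)%:E * (g2 y)%:E)%E).
- by apply/measurable_EFinP; exact: measurableT_comp.
- move=> y _; rewrite -EFinM lee_fin (le_trans (fg x y))// ler_norm//.
- exact: (integrableZl measurableT _ ig2).
Qed.

Lemma dominated_integrable_pair2 y :
  m1.-integrable setT (fun x => (f (x, y))%:E).
Proof.
apply: (@le_integrable _ _ _ _ _ measurableT _ (fun x => (g2 y)%:E * (g1 x)%:E)%E).
- by apply/measurable_EFinP; exact: measurableT_comp.
- move=> x _; rewrite -EFinM lee_fin (le_trans (fg x y))// mulrC ler_norm//.
- exact: (integrableZl measurableT _ ig1).
Qed.

(** The product bound makes the iterated integral of [|f|] at most the product of the integrals of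
    [|g1|] and [|g2|], so Tonelli applies. *)
Lemma dominated_integrable_prod : (m1 \x m2)%E.-integrable setT (EFin \o f).
Proof.
have [mg1 oo1] := integrableP _ _ _ ig1.
have [mg2 oo2] := integrableP _ _ _ ig2.
have mng1 : measurable_fun setT (fun x => `|(g1 x)%:E|%E).
  by apply: measurableT_comp.
have mng2 : measurable_fun setT (fun x => `|(g2 x)%:E|%E).
  by apply: measurableT_comp.
have mEf : measurable_fun setT (EFin \o f) by exact/measurable_EFinP.
have mnf : measurable_fun setT (fun z => `|(f z)%:E|%E).
  by apply: measurableT_comp.
apply/integrable12ltyP => //.
apply: (@le_lt_trans _ _ (\int[m1]_x (`|(g1 x)%:E| * \int[m2]_y `|(g2 y)%:E|)))%E.
  apply: ge0_le_integral => //.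
  - by move=> x _; apply: integral_ge0.
  - exact: (measurable_fun_fubini_tonelli_F (fun z => `|(f z)%:E|%E)).
  - exact: emeasurable_funM.
  - move=> x _; rewrite -ge0_integralZl//.
    apply: ge0_le_integral => //.
    + exact: measurable_fun_pair2 mnf.
    + exact: emeasurable_funM.
    + move=> y _; rewrite -abseM lee_fin (le_trans (fg x y))// ler_norm//.
rewrite ge0_integralZr//; last exact: integral_ge0.
by rewrite lte_mul_pinfty//; [exact: integral_ge0|
  rewrite ge0_fin_numE//; exact: integral_ge0].
Qed.

(** Domination holds at every [x], not just almost everywhere, so all sections are integrable and
    taking [fine] loses nothing. *)
Lemma dominated_fubini_FE : fubini_F m2 (EFin \o f) =
  EFin \o (fun x => \int[m2]_y f (x, y)).
Proof.
apply/funext => x; rewrite /fubini_F /Rintegral/= fineK//.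
exact/integrable_fin_num/dominated_integrable_pair1.
Qed.

Lemma dominated_fubini_GE : fubini_G m1 (EFin \o f) =
  EFin \o (fun y => \int[m1]_x f (x, y)).
Proof.
apply/funext => y; rewrite /fubini_G /Rintegral/= fineK//.
exact/integrable_fin_num/dominated_integrable_pair2.
Qed.

Lemma dominated_integrable1 :
  m1.-integrable setT (EFin \o (fun x => \int[m2]_y f (x, y))).
Proof.
rewrite -dominated_fubini_FE.
exact/integrable_fubini_F/dominated_integrable_prod.
Qed.

Lemma dominated_Rintegral12 :
  \int[(m1 \x m2)%E]_z f z = \int[m1]_x \int[m2]_y f (x, y).
Proof.
rewrite /Rintegral -(integral12_prod_meas1 dominated_integrable_prod).
by congr fine; apply: eq_integral => x _; rewrite dominated_fubini_FE.
Qed.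

Lemma dominated_Fubini :
  \int[m1]_x \int[m2]_y f (x, y) = \int[m2]_y \int[m1]_x f (x, y).
Proof.
rewrite -dominated_Rintegral12 /Rintegral.
rewrite -(integral21_prod_meas1 dominated_integrable_prod).
by congr fine; apply: eq_integral => x _; rewrite dominated_fubini_GE.
Qed.

End dominated_Fubini.

Section derivative_integral.
Context {R : realType}.
Notation mu := (@lebesgue_measure R).

(** Limits along the integers are enough: the integrals over [[-n, n]] tend to the full integral by
    dominated convergence, and to 0 by the fundamental theorem. *)
Lemma Rintegral_derive_eq0 (F f : R -> R) :
  (forall x : R, is_derive x 1 F (f x)) -> continuous f ->
  mu.-integrable setT (EFin \o f) ->
  F n%:R @[n --> \oo] --> (0 : R) -> F (- n%:R) @[n --> \oo] --> (0 : R) ->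
  \int[mu]_x f x = 0.
Proof.
move=> dF cf intf Fy FNy.
have [mf _] := integrableP _ _ _ intf.
pose D (n : nat) : set R := `[- n%:R, n%:R]%classic.
(* The index [n.+1] keeps the interval nondegenerate. *)
have FTC n : (\int[mu]_(x in D n.+1) (f x)%:E = (F n.+1%:R - F (- n.+1%:R))%:E)%E.
  rewrite EFinB; apply: continuous_FTC2.
  - by rewrite -subr_gt0 opprK -natrD ltr0n.
  - exact: continuous_subspaceT.
  - split.
    + by move=> x _; exact: ex_derive.
    + apply: cvg_at_right_filter; apply: differentiable_continuous.
      by apply/derivable1_diffP; exact: ex_derive.
    + apply: cvg_at_left_filter; apply: differentiable_continuous.
      by apply/derivable1_diffP; exact: ex_derive.
  - by move=> x _; rewrite derive1E derive_val.
have c1 : (\int[mu]_(x in D n.+1) (f x)%:E)%E @[n --> \oo] --> 0%E.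
  under eq_fun do rewrite FTC.
  apply: cvg_EFin; first exact: nearW.
  rewrite /comp/= (_ : 0 = 0 - 0); last by rewrite subr0.
  have FyS := @cvg_shiftS _ (fun n => F n%:R) (nbhs (0 : R)).
  have FNyS := @cvg_shiftS _ (fun n => F (- n%:R)) (nbhs (0 : R)).
  by apply: cvgB; [rewrite FyS|rewrite FNyS].
have c2 : (\int[mu]_(x in D n.+1) (f x)%:E)%E @[n --> \oo] --> (\int[mu]_x (f x)%:E)%E.
  under eq_fun do rewrite integral_mkcond.
  apply: (@dominated_cvg _ _ _ mu _ measurableT
    (fun n => (EFin \o f) \_ (D n.+1)) _ (abse \o (EFin \o f))) => //.
  - move=> n; apply/(measurable_restrictT _ _).1; first exact: measurable_itv.
    exact: measurable_funTS mf.
  - move=> x _; apply: (@cvg_near_cst).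
    near=> n; rewrite patchE ifT// inE /D/= in_itv/= -ler_norml.
    by near: n; apply: filterS (nbhs_infty_ger `|x|) => n /le_trans; apply; rewrite ler_nat.
  - exact: integrable_abse.
  - by move=> n x _; rewrite patchE; case: ifPn => _; [exact: lexx|rewrite abse0 abse_ge0].
by rewrite /Rintegral -(cvg_unique _ c1 c2).
Unshelve. all: end_near. Qed.

End derivative_integral.

(** * The one-dimensional characteristic function *)

Section gauss1.
Context {R : realType}.
Variables (a s : R).
Hypothesis s0 : 0 < s.
Notation mu := (@lebesgue_measure R).
Notation p := (normal_pdf a s).
Let sn0 : s != 0. Proof. by rewrite gt_eqF. Qed.

Lemma is_derive_normal_pdf (x : R) :
  is_derive x 1 p (- (x - a) / s ^+ 2 * p x).
Proof.
pose q : R -> R := (- (s ^+ 2 *+ 2)^-1) \*: ((id - cst a) ^+ 2).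
have -> : p = normal_peak s \*: (expR \o q).
  apply/funext => y; rewrite normal_pdfE// /normal_fun /q /= !fctE /=.
  congr (_ * expR _); rewrite /GRing.scale/= -!mulNr.
  by rewrite mulrC !mulNr mulrN expr2.
have dq : is_derive x 1 q (- (x - a) / s ^+ 2).
  apply: is_derive_eq; rewrite /GRing.scale/= !fctE /= subr0 expr1.
  by field.
have de : is_derive x 1 (expR \o q) (expR (q x) * (- (x - a) / s ^+ 2)).
  exact: is_derive1_comp.
apply: is_derive_eq.
rewrite -[RHS]/(- (x - a) / s ^+ 2 * (normal_peak s * expR (q x))).
rewrite -[LHS]/(normal_peak s * (expR (q x) * (- (x - a) / s ^+ 2))).
by rewrite mulrA mulrC.
Qed.

Lemma is_derive_sin_affine (c d x : R) :
  is_derive x 1 (fun y : R => sin (c + d * (y - a))) (d * cos (c + d * (x - a))).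
Proof.
pose q : R -> R := cst c + (d \*: (id - cst a)).
have dq : is_derive x 1 q d.
  by apply: is_derive_eq; rewrite /GRing.scale/= add0r subr0 mulr1.
have : is_derive x 1 (sin \o q) (cos (q x) * d) by exact: is_derive1_comp.
by move=> h; apply: (is_derive_eq h); rewrite mulrC.
Qed.

(** Here the variable is the frequency, for differentiation under the integral sign; in
    [is_derive_sin_affine] it is the position, for integration by parts. *)
Lemma is_derive_cos_slope (c d x : R) :
  is_derive x 1 (fun y : R => cos (c + y * d)) (- d * sin (c + x * d)).
Proof.
pose q : R -> R := cst c + (d \*: id).
have dq : is_derive x 1 q d.
  by apply: is_derive_eq; rewrite /GRing.scale/= add0r mulr1.
have qE y : q y = c + y * d by rewrite /q !fctE /= /GRing.scale/= mulrC.
have : is_derive x 1 (cos \o q) (- sin (q x) * d) by exact: is_derive1_comp.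
rewrite (_ : cos \o q = (fun y => cos (c + y * d))); last first.
  by apply/funext => y; rewrite /= qE.
by move=> h; apply: (is_derive_eq h); rewrite qE; ring.
Qed.

(** A density with doubled standard deviation, so integrability is immediate; the factor makes its
    value at [a] equal to [2 * s * normal_peak s]. *)
Definition gauss_dom (x : R) := (2 * s * normal_peak s / normal_peak (2 * s)) *
  normal_pdf a (2 * s) x.

Lemma ler_expR_sqr (z : R) : `|z| <= expR (z ^+ 2).
Proof.
apply: le_trans (expR_ge1Dx _); rewrite -(real_normK (num_real z)).
by have := sqr_ge0 (`|z| - 1); nra.
Qed.

(* With z = (x - a) / (2 s), the bound reads |z| <= e^(z^2) <= e^(3 z^2 / 2). *)
Lemma normal_pdf_moment_bound x : `|(x - a) * p x| <= gauss_dom x.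
Proof.
have s20 : 2 * s != 0 by rewrite mulf_neq0.
have P0 : 0 < normal_peak (2 * s) by exact: normal_peak_gt0.
rewrite /gauss_dom normrM (ger0_norm (normal_pdf_ge0 _ _ _)) !normal_pdfE//.
have [z xE] : exists z, x - a = 2 * s * z by exists ((x - a) / (2 * s)); field.
have -> : normal_fun a s x = expR (- (2 * z ^+ 2)).
  by congr expR; rewrite xE; field.
have -> : normal_fun a (2 * s) x = expR (- (z ^+ 2 / 2)).
  by congr expR; rewrite xE; field.
rewrite xE.
rewrite normrM gtr0_norm ?mulr_gt0//.
rewrite (_ : _ / _ * _ = 2 * s * normal_peak s * expR (- (z ^+ 2 / 2))); last first.
  by field; rewrite gt_eqF.
rewrite -!mulrA ler_pM2l// ler_pM2l// mulrCA ler_pM2l ?normal_peak_gt0//.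
apply: (@le_trans _ _ (expR (z ^+ 2) * expR (- (2 * z ^+ 2)))).
  by rewrite ler_pM2r ?expR_gt0// ler_expR_sqr.
rewrite -expRD ler_expR; have := sqr_ge0 z; lra.
Qed.

Lemma integrable_gauss_dom : mu.-integrable setT (EFin \o gauss_dom).
Proof.
have := integrableZl measurableT (2 * s * normal_peak s / normal_peak (2 * s))
  (integrable_normal_pdf a (2 * s)).
by apply: eq_integrable => // x _; rewrite EFinM.
Qed.

Lemma gauss_dom_ge0 x : 0 <= gauss_dom x.
Proof.
by rewrite mulr_ge0 ?normal_pdf_ge0// !mulr_ge0 ?invr_ge0 ?normal_peak_ge0// ltW.
Qed.

End gauss1.

Lemma cvg_normal_pdf_y {R : realType} (a s : R) : 0 < s ->
  normal_pdf a s n%:R @[n --> \oo] --> (0 : R).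
Proof.
move=> s0; rewrite normal_pdfE ?gt_eqF//.
rewrite -[X in _ --> X](mulr0 (normal_peak s)); apply: cvgM; first exact: cvg_cst.
rewrite /normal_fun; under eq_fun do rewrite mulNr.
apply: (cvg_comp (fun n : nat => ((n%:R : R) - a) ^+ 2 / (s ^+ 2 *+ 2))
  (fun x => expR (- x))); last exact: cvgr_expR.
have s20 : 0 < (s ^+ 2 *+ 2)^-1 by rewrite invr_gt0 mulrn_wgt0// exprn_gt0.
apply: (cvg_comp (fun n : nat => ((n%:R : R) - a) ^+ 2)
  (fun x => x / (s ^+ 2 *+ 2))); last exact: (gt0_cvgMly s20 cvg_id).
apply: (cvg_comp (fun n : nat => (n%:R : R) - a) (fun x => x ^+ 2)); last exact: cvgr_expr2.
apply: (cvg_comp (fun n : nat => (n%:R : R)) (fun x => x - a)); first exact: cvgr_idn.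
exact: cvg_addrr.
Qed.

Lemma normal_pdfN {R : realType} (a s x : R) : s != 0 ->
  normal_pdf a s (- x) = normal_pdf (- a) s x.
Proof.
move=> sn0; rewrite !normal_pdfE//; congr (_ * expR _).
by congr (- _ / _); ring.
Qed.

Section gauss_characteristic.
Context {R : realType}.
Variables (a s : R).
Hypothesis s0 : 0 < s.
Notation mu := (@lebesgue_measure R).
Notation p := (normal_pdf a s).
Let sn0 : s != 0. Proof. by rewrite gt_eqF. Qed.

Let mp : measurable_fun setT p. Proof. exact: measurable_normal_pdf. Qed.

Let int_bounded (k : R -> R) : continuous k -> (forall x, `|k x| <= 1) ->
  mu.-integrable setT (EFin \o (fun x => p x * k x)).
Proof.
move=> ck k1; apply: le_integrable (integrable_normal_pdf a s) => //.
  apply/measurable_EFinP; apply: measurable_funM => //.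
  exact: continuous_measurable_fun.
move=> x _; rewrite lee_fin normrM ler_piMr//.
Qed.

Let int_moment (k : R -> R) : continuous k -> (forall x, `|k x| <= 1) ->
  mu.-integrable setT (EFin \o (fun x => (x - a) * p x * k x)).
Proof.
move=> ck k1; apply: le_integrable (integrable_gauss_dom a s) => //.
  apply/measurable_EFinP; apply: measurable_funM; last exact: continuous_measurable_fun.
  by apply: measurable_funM => //; exact: measurable_funB.
move=> x _; rewrite lee_fin (ger0_norm (gauss_dom_ge0 _ s0 _)).
apply: le_trans (normal_pdf_moment_bound a s0 x).
by rewrite normrM ler_piMr.
Qed.

Let continuous_cos_affine (c d : R) : continuous (fun x => cos (c + d * (x - a))).
Proof.
move=> x; apply: (@continuous_comp _ _ _ (fun x : R => c + d * (x - a)) cos).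
  apply: cvgD; first exact: cvg_cst.
  by apply: cvgM; [exact: cvg_cst|apply: cvgB; [exact: cvg_id|exact: cvg_cst]].
exact: continuous_cos.
Qed.

Let continuous_sin_affine (c d : R) : continuous (fun x => sin (c + d * (x - a))).
Proof.
move=> x; apply: (@continuous_comp _ _ _ (fun x : R => c + d * (x - a)) sin).
  apply: cvgD; first exact: cvg_cst.
  by apply: cvgM; [exact: cvg_cst|apply: cvgB; [exact: cvg_id|exact: cvg_cst]].
exact: continuous_sin.
Qed.

(** Stein's identity E[(X - a) k(X)] = s^2 E[k'(X)] for a sine [k]: up to the factor [s ^+ 2], the
    two sides differ by the integral of the derivative of [p * k], which vanishes at infinity
    because [|k| <= 1]. *)
Lemma gauss_sin_by_parts (c d : R) :
  \int[mu]_x ((x - a) * p x * sin (c + d * (x - a))) =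
  s ^+ 2 * d * \int[mu]_x (p x * cos (c + d * (x - a))).
Proof.
pose F x := p x * sin (c + d * (x - a)).
pose f x := - (s ^+ 2)^-1 * ((x - a) * p x * sin (c + d * (x - a)))
  + d * (p x * cos (c + d * (x - a))).
have is1 := int_moment (@continuous_sin_affine c d) (fun x => sin_max _).
have ic1 := int_bounded (@continuous_cos_affine c d) (fun x => cos_max _).
have is1' : mu.-integrable setT (EFin \o
    (fun x => - (s ^+ 2)^-1 * ((x - a) * p x * sin (c + d * (x - a))))).
  exact: (integrableZl measurableT _ is1).
have ic1' : mu.-integrable setT (EFin \o (fun x => d * (p x * cos (c + d * (x - a))))).
  exact: (integrableZl measurableT _ ic1).
have Fp x : `|F x| <= p x.
  by rewrite normrM (ger0_norm (normal_pdf_ge0 _ _ _)) ler_piMr ?normal_pdf_ge0// sin_max.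
have : \int[mu]_x f x = 0.
  apply: (@Rintegral_derive_eq0 _ F).
  - move=> x; rewrite /F /f.
    have dp := is_derive_normal_pdf a s0 x.
    have ds : is_derive x 1 (fun y : R => sin (c + d * (y - a)))
        (d * cos (c + d * (x - a))) by exact: is_derive_sin_affine.
    apply: (is_derive_eq (is_deriveM dp ds)); rewrite /GRing.scale/=.
    by field.
  - have cp : continuous p by exact: continuous_normal_pdf.
    move=> x; apply: cvgD; (apply: cvgM; first exact: cvg_cst).
      apply: cvgM; last exact: continuous_sin_affine.
      apply: cvgM; last exact: cp.
      by apply: cvgB; [exact: cvg_id|exact: cvg_cst].
    by apply: cvgM; [exact: cp|exact: continuous_cos_affine].
  - exact: (integrableD measurableT is1' ic1').
  - apply/cvgr0Pnorm_lt => e e0; have /cvgr0Pnorm_lt/(_ _ e0) := cvg_normal_pdf_y a s0.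
    apply: filterS => n; apply: le_lt_trans.
    by rewrite (ger0_norm (normal_pdf_ge0 _ _ _)).
  - apply/cvgr0Pnorm_lt => e e0; have /cvgr0Pnorm_lt/(_ _ e0) := cvg_normal_pdf_y (- a) s0.
    apply: filterS => n; apply: le_lt_trans.
    by rewrite (ger0_norm (normal_pdf_ge0 _ _ _)) -normal_pdfN.
rewrite /f RintegralD// !RintegralZl//.
move/eqP; rewrite mulNr addrC subr_eq0 => /eqP h.
by rewrite -mulrA h; field.
Qed.

(* As a function of t the integral solves F' = - s^2 t F: differentiate under the
   integral sign, then integrate by parts. *)
Lemma gauss_cos_centered (c t : R) :
  \int[mu]_x (p x * cos (c + t * (x - a))) = expR (- (s ^+ 2 * t ^+ 2 / 2)) * cos c.
Proof.
pose F t := \int[mu]_x (p x * cos (c + t * (x - a))).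
pose g t x := p x * cos (c + t * (x - a)).
have dg (u x : R) : is_derive u 1 (g ^~ x) (- ((x - a) * p x * sin (c + u * (x - a)))).
  have h := is_derive_cos_slope c (x - a) u.
  have := is_deriveM (is_derive_cst (p x) u 1) h.
  by move=> k; apply: (is_derive_eq k); rewrite /GRing.scale/= mulr0 addr0; ring.
have dF (u : R) : is_derive u 1 F (- (s ^+ 2 * u * F u)).
  have uI : `]u - 1, u + 1[%classic u.
    by rewrite /= in_itv/=; apply/andP; split; lra.
  have ig x : `]u - 1, u + 1[%classic x -> mu.-integrable setT (EFin \o g x).
    move=> _; exact: int_bounded (@continuous_cos_affine c x) (fun x => cos_max _).
  have deg x y : `]u - 1, u + 1[%classic x -> [set: R] y -> derivable (g ^~ y) x 1.
    by move=> _ _; exact: ex_derive.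
  have ub x y : `]u - 1, u + 1[%classic x -> [set: R] y ->
      `|partial1of2 g x y| <= gauss_dom a s y.
    move=> _ _; rewrite partial1of2E derive_val normrN.
    apply: le_trans (normal_pdf_moment_bound a s0 y).
    by rewrite normrM ler_piMr ?sin_max.
  have := differentiation_under_integral measurableT uI ig deg
    (gauss_dom_ge0 a s0) (integrable_gauss_dom a s) ub.
  have := derivable_under_integral measurableT uI ig deg
    (gauss_dom_ge0 a s0) (integrable_gauss_dom a s) ub.
  move=> dF FE; apply: DeriveDef => //.
  rewrite -derive1E FE; under eq_Rintegral do rewrite partial1of2E derive_val.
  rewrite -gauss_sin_by_parts.
  under eq_Rintegral do rewrite -mulN1r.
  by rewrite RintegralZl ?mulN1r//; exact: int_moment (@continuous_sin_affine c u) (fun x => sin_max _).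
(* Integrating factor of the differential equation: [E * F] has derivative 0, hence keeps its value
   at 0. *)
pose E (u : R) := expR (s ^+ 2 / 2 * u ^+ 2).
have dE (u : R) : is_derive u 1 E (s ^+ 2 * u * E u).
  pose q : R -> R := (s ^+ 2 / 2) \*: (id ^+ 2).
  have dq : is_derive u 1 q (s ^+ 2 * u).
    by apply: is_derive_eq; rewrite /GRing.scale/= expr1; field.
  have : is_derive u 1 (expR \o q) (expR (q u) * (s ^+ 2 * u)) by exact: is_derive1_comp.
  by move=> h; apply: (is_derive_eq h); rewrite mulrC.
have EF0 (u : R) : is_derive u 1 (fun u => E u * F u) 0.
  apply: (is_derive_eq (is_deriveM (dE u) (dF u))); rewrite /GRing.scale/=; ring.
have := is_derive_0_is_cst t 0 EF0.
rewrite /E expr0n/= mulr0 expR0 mul1r => EFt.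
have F0 : F 0 = cos c.
  rewrite /F; under eq_Rintegral do rewrite mul0r addr0 mulrC.
  rewrite RintegralZl//; last exact: integrable_normal_pdf.
  by rewrite /Rintegral integral_normal_pdf mulr1.
rewrite F0 in EFt; rewrite -EFt mulrA -expRD.
by rewrite (_ : _ + _ = 0) ?expR0 ?mul1r//; field.
Qed.

Lemma gauss_cos (c t : R) :
  \int[mu]_x (p x * cos (c + t * x)) = expR (- (s ^+ 2 * t ^+ 2 / 2)) * cos (c + t * a).
Proof.
rewrite -gauss_cos_centered; apply: eq_Rintegral => x _.
by congr (_ * cos _); ring.
Qed.

End gauss_characteristic.

(** * Measurability of continuous functions of a row vector *)

Section continuous_rV.
Context {R : realType} (n : nat).
Implicit Types u : 'rV[R]_n.

(* The grid of mesh 1/(k+1); a function of [grid_index] takes countably many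
   values, hence is measurable whatever it is. *)
Definition grid_index k u : 'rV[int]_n := \row_i Num.floor (u 0 i * k.+1%:R).
Definition grid_round k u : 'rV[R]_n := \row_i ((Num.floor (u 0 i * k.+1%:R))%:~R / k.+1%:R).

Lemma measurable_fun_grid_index d (T : measurableType d) k (f : 'rV[int]_n -> T) :
  measurable_fun setT (f \o grid_index k).
Proof.
move=> _ A mA; rewrite setTI.
have -> : (f \o grid_index k) @^-1` A =
    \bigcup_(z in [set: 'rV[int]_n]) ([set u | grid_index k u = z] `&` [set _ | A (f z)]).
  apply/seteqP; split => [u /= Au|u [z _ /= [<-]]//].
  by exists (grid_index k u).
apply: countable_bigcupT_measurable; first exact: countableP.
move=> z; apply: measurableI; last first.
  have [Afz|nAfz] := pselect (A (f z)).
    by rewrite (_ : [set _ | _] = setT)//; apply/seteqP; split.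
  by rewrite (_ : [set _ | _] = set0)//; apply/seteqP; split.
have -> : [set u | grid_index k u = z] =
    \bigcap_(i in [set: 'I_n]) [set u | Num.floor (u 0 i * k.+1%:R) = z 0 i].
  apply/seteqP; split => [u /= <- i _ /=|u /= uz]; first by rewrite mxE.
  by apply/rowP => i; rewrite mxE; exact: uz.
apply: fin_bigcap_measurable => // i _.
have mM : measurable_fun setT (fun u => u 0 i * k.+1%:R).
  by apply: measurable_funM => //; exact: measurable_coord_rV.
rewrite [X in measurable X](_ : _ =
  (fun u => u 0 i * k.+1%:R) @^-1` `[(z 0 i)%:~R, (z 0 i + 1)%:~R[); last first.
  apply/seteqP; split => u /=; rewrite in_itv/=.
    by move=> <-; rewrite floor_le_tmp floorD1_gt.
  by move=> h; apply: floor_def.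
by rewrite -[X in measurable X]setTI; exact: mM.
Qed.

Lemma cvg_grid_round u : grid_round k u @[k --> \oo] --> u.
Proof.
move=> A [P uP PA].
have h : \forall k \near \oo, forall i j, P i j (grid_round k u i j).
  apply: filter_forall => i; apply: filter_forall => j.
  rewrite ord1; apply: (_ : (grid_round k u 0 j @[k --> \oo] --> u 0 j)); last first.
    by have := uP i j; rewrite ord1.
  apply/cvgrPdist_lt => e e0; near=> k; rewrite mxE.
  have k0 : (0 : R) < k.+1%:R by rewrite ltr0n.
  have fl := floor_le_tmp (u 0 j * k.+1%:R).
  have fg := floorD1_gt (u 0 j * k.+1%:R).
  rewrite ger0_norm; last by rewrite subr_ge0 ler_pdivrMr.
  apply: (@le_lt_trans _ _ k.+1%:R^-1); last first.
    by near: k; exact: near_infty_natSinv_lt (PosNum e0).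
  rewrite -(ler_pM2r k0) mulVf ?gt_eqF// mulrBl divfK ?gt_eqF//.
  by move: fg; rewrite intrD => /ltW; rewrite lerBlDl.
by near=> k; apply: PA; near: k.
Unshelve. all: end_near. Qed.

(** The sigma-algebra is generated by the coordinates rather than by the open sets, so this link to
    the topology must be made: [h] is the pointwise limit of its values at grid points, each a
    function of [grid_index]. *)
Lemma continuous_measurable_rV (h : 'rV[R]_n -> R) :
  continuous h -> measurable_fun setT h.
Proof.
move=> ch; apply: (@measurable_fun_cvg _ _ _ _ (fun k u => h (grid_round k u))).
  move=> k; rewrite (_ : (fun u => _) =
    (fun z : 'rV[int]_n => h (\row_i ((z 0 i)%:~R / k.+1%:R))) \o grid_index k).
    exact: measurable_fun_grid_index.
  by apply/funext => u /=; congr h; apply/rowP => i; rewrite !mxE.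
move=> u _; apply: (cvg_comp (fun k => grid_round k u) h); last exact: ch.
exact: cvg_grid_round.
Qed.

End continuous_rV.

Lemma measurable_fun_cos (R : realType) d (T : measurableType d) (f : T -> R) :
  measurable_fun setT f -> measurable_fun setT (fun x => cos (f x)).
Proof.
move=> mf; apply: (measurableT_comp _ mf).
exact: (continuous_measurable_fun (@continuous_cos R)).
Qed.

Lemma measurable_fun_sin (R : realType) d (T : measurableType d) (f : T -> R) :
  measurable_fun setT f -> measurable_fun setT (fun x => sin (f x)).
Proof.
move=> mf; apply: (measurableT_comp _ mf).
exact: (continuous_measurable_fun (@continuous_sin R)).
Qed.

(** * Coordinatewise integration and the Gaussian on row vectors *)

Section cons_integral.
Context {R : realType}.
Notation mu := (@lebesgue_measure R).

Lemma Rintegral_cons n (f : 'rV[R]_n.+1 -> R) :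
  measurable_fun setT f ->
  (mu \x lebesgue_rV n)%E.-integrable setT (EFin \o (f \o @cons_rV R n)) ->
  \int[lebesgue_rV n.+1]_u f u =
  \int[(mu \x lebesgue_rV n)%E]_z f (cons_rV z).
Proof.
move=> mf intf; rewrite /Rintegral; congr fine.
have mEf : measurable_fun setT (EFin \o f) by exact/measurable_EFinP.
transitivity (\int[pushforward (mu \x lebesgue_rV n) (@cons_rV R n)]_x (f x)%:E)%E => //.
by apply: integral_pushforward => //; exact: measurable_cons_rV.
Qed.

Lemma ge0_integral_cons n (f : 'rV[R]_n.+1 -> R) :
  measurable_fun setT f -> (forall x, 0 <= f x) ->
  (\int[lebesgue_rV n.+1]_u (f u)%:E =
  \int[mu]_x \int[lebesgue_rV n]_w (f (cons_rV (x, w)))%:E)%E.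
Proof.
move=> mf f0.
have mEf : measurable_fun setT (EFin \o f) by exact/measurable_EFinP.
transitivity (\int[mu \x lebesgue_rV n]_z (f (cons_rV z))%:E)%E.
  transitivity (\int[pushforward (mu \x lebesgue_rV n) (@cons_rV R n)]_x (f x)%:E)%E => //.
  apply: ge0_integral_pushforward => //; first exact: measurable_cons_rV.
  by move=> x _; rewrite lee_fin.
apply: fubini_tonelli1.
  by apply: (measurableT_comp mEf); exact: measurable_cons_rV.
by move=> x; rewrite lee_fin.
Qed.

Lemma cons_rV0 n (z : R * 'rV[R]_n) : cons_rV z 0 0 = z.1.
Proof. by rewrite mxE unlift_none. Qed.

Lemma cons_rV_lift n (z : R * 'rV[R]_n) j : cons_rV z 0 (lift ord0 j) = z.2 0 j.
Proof. by rewrite mxE liftK. Qed.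

Lemma measurable_prod_coord n (k : 'I_n -> R -> R) :
  (forall i, measurable_fun setT (k i)) ->
  measurable_fun setT (fun x : 'rV[R]_n => \prod_i k i (x 0 i)).
Proof.
move=> mk; apply: measurable_prod => i _.
by apply: measurableT_comp => //; exact: measurable_coord_rV.
Qed.

Lemma integral_prod_rV n (k : 'I_n -> R -> R) (c : 'I_n -> R) :
  (forall i, measurable_fun setT (k i)) -> (forall i x, 0 <= k i x) ->
  (forall i, \int[mu]_x (k i x)%:E = (c i)%:E)%E ->
  (\int[lebesgue_rV n]_x (\prod_i k i (x 0 i))%:E = (\prod_i c i)%:E)%E.
Proof.
elim: n => [|n IH] in k c * => mk k0 kc.
  rewrite /= integral_dirac//; first by rewrite !big_ord0 diracT mul1e.
  by apply/measurable_EFinP; exact: (measurable_prod_coord mk).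
rewrite ge0_integral_cons; last 2 first.
- exact: (measurable_prod_coord mk).
- by move=> x; apply: prodr_ge0.
have c0 i : 0 <= c i.
  by rewrite -lee_fin -kc; apply: integral_ge0 => x _; rewrite lee_fin.
transitivity (\int[mu]_x ((k ord0 x)%:E * (\prod_i c (lift ord0 i))%:E))%E.
  apply: eq_integral => x _.
  rewrite (eq_integral (fun w : 'rV[R]_n =>
      (k ord0 x)%:E * (\prod_i k (lift ord0 i) (w 0 i))%:E)%E); last first.
    move=> w _; rewrite big_ord_recl cons_rV0 EFinM; congr (_ * EFin _)%E.
    by apply: eq_bigr => i _; rewrite cons_rV_lift.
  rewrite ge0_integralZl//.
  - congr (_ * _)%E.
    exact: (IH (fun i => k (lift ord0 i)) (fun i => c (lift ord0 i))).
  - apply/measurable_EFinP.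
    exact: (@measurable_prod_coord _ (fun i => k (lift ord0 i))).
  - by move=> w _; rewrite lee_fin; exact: prodr_ge0.
  - by rewrite lee_fin.
rewrite ge0_integralZr//.
- by rewrite kc -EFinM [in RHS]big_ord_recl.
- by apply/measurable_EFinP; exact: mk.
- by move=> x _; rewrite lee_fin.
- by rewrite lee_fin; exact: prodr_ge0.
Qed.

Lemma measurable_dot n : measurable_fun setT
  (fun z : 'rV[R]_n * 'rV[R]_n => dot z.1 z.2).
Proof.
apply: measurable_sum => i; apply: measurable_funM.
  exact: (measurableT_comp (measurable_coord_rV i) measurable_fst).
exact: (measurableT_comp (measurable_coord_rV i) measurable_snd).
Qed.

Lemma measurable_dotl n (u : 'rV[R]_n) : measurable_fun setT (fun w => dot w u).
Proof. exact: measurable_fun_pair1 (@measurable_dot n). Qed.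

Lemma measurable_dotr n (w : 'rV[R]_n) : measurable_fun setT (fun u => dot w u).
Proof. exact: measurable_fun_pair2 (@measurable_dot n). Qed.

Lemma dotC n (u w : 'rV[R]_n) : dot u w = dot w u.
Proof. by apply: eq_bigr => i _; rewrite mulrC. Qed.

End cons_integral.

Section gauss_rV.
Context {R : realType}.
Notation mu := (@lebesgue_measure R).

Definition gauss_rV n (s : R) (a x : 'rV[R]_n) : R :=
  \prod_i normal_pdf (a 0 i) s (x 0 i).

Lemma gauss_rV_ge0 n s (a x : 'rV[R]_n) : 0 <= gauss_rV s a x.
Proof. by apply: prodr_ge0 => i _; exact: normal_pdf_ge0. Qed.

Lemma measurable_gauss_rV n s (a : 'rV[R]_n) : measurable_fun setT (gauss_rV s a).
Proof.
apply: (@measurable_prod_coord _ _ (fun i => normal_pdf (a 0 i) s)) => i.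
exact: measurable_normal_pdf.
Qed.

Lemma integral_gauss_rV n s (a : 'rV[R]_n) :
  (\int[lebesgue_rV n]_x (gauss_rV s a x)%:E = 1)%E.
Proof.
rewrite (@integral_prod_rV _ _ (fun i => normal_pdf (a 0 i) s) (fun=> 1)).
- by rewrite big1.
- by move=> i; exact: measurable_normal_pdf.
- by move=> i x; exact: normal_pdf_ge0.
- by move=> i; exact: integral_normal_pdf.
Qed.

Lemma integrable_gauss_rV n s (a : 'rV[R]_n) :
  (lebesgue_rV n).-integrable setT (EFin \o gauss_rV s a).
Proof.
apply/integrableP; split; first by apply/measurable_EFinP; exact: measurable_gauss_rV.
rewrite (eq_integral (fun x => (gauss_rV s a x)%:E)).
  by rewrite integral_gauss_rV ltry.
by move=> x _; rewrite /= ger0_norm// gauss_rV_ge0.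
Qed.

Lemma Rintegral_gauss_rV n s (a : 'rV[R]_n) :
  \int[lebesgue_rV n]_x gauss_rV s a x = 1.
Proof. by rewrite /Rintegral integral_gauss_rV. Qed.

Lemma gauss_rV_cons n s (a : 'rV[R]_n.+1) z :
  gauss_rV s a (cons_rV z) =
  normal_pdf (a 0 0) s z.1 * gauss_rV s (\row_j a 0 (lift ord0 j)) z.2.
Proof.
rewrite /gauss_rV big_ord_recl cons_rV0; congr (_ * _).
by apply: eq_bigr => i _; rewrite cons_rV_lift mxE.
Qed.

Lemma dot_cons n (t : 'rV[R]_n.+1) z :
  dot t (cons_rV z) = t 0 0 * z.1 + dot (\row_j t 0 (lift ord0 j)) z.2.
Proof.
rewrite /dot big_ord_recl cons_rV0; congr (_ + _).
by apply: eq_bigr => i _; rewrite cons_rV_lift mxE.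
Qed.

Lemma dot_recl n (t u : 'rV[R]_n.+1) :
  dot t u = t 0 0 * u 0 0 + dot (\row_j t 0 (lift ord0 j)) (\row_j u 0 (lift ord0 j)).
Proof.
by rewrite /dot big_ord_recl; congr (_ + _); apply: eq_bigr => i _; rewrite !mxE.
Qed.

(** The phase [c] is what makes the induction close: fixing the first coordinate [x] adds
    [t 0 0 * x] to the phase of the remaining integral. The choice [c = - (pi / 2)] also yields the
    sine. *)
Lemma gauss_rV_cos n s (a t : 'rV[R]_n) (c : R) : 0 < s ->
  \int[lebesgue_rV n]_x (gauss_rV s a x * cos (c + dot t x)) =
  expR (- (s ^+ 2 * dot t t / 2)) * cos (c + dot t a).
Proof.
move=> s0; elim: n => [|n IH] in a t c *.
  rewrite /Rintegral /= integral_dirac//.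
    rewrite diracT mul1e/= /gauss_rV big_ord0 mul1r /dot !big_ord0.
    by rewrite mulr0 mul0r oppr0 expR0 mul1r.
  apply/measurable_EFinP; apply: measurable_funM; first exact: measurable_gauss_rV.
  apply: measurable_fun_cos.
  by apply: measurable_funD => //; exact: measurable_dotr.
set a' : 'rV[R]_n := \row_j a 0 (lift ord0 j).
set t' : 'rV[R]_n := \row_j t 0 (lift ord0 j).
pose f (z : measurableTypeR R * 'rV[R]_n) := gauss_rV s a (cons_rV z) * cos (c + dot t (cons_rV z)).
have mf0 : measurable_fun setT (fun x => gauss_rV s a x * cos (c + dot t x)).
  apply: measurable_funM; first exact: measurable_gauss_rV.
  apply: measurable_fun_cos.
  by apply: measurable_funD => //; exact: measurable_dotr.
have mf : measurable_fun setT f.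
  by apply: (measurableT_comp mf0); exact: measurable_cons_rV.
have fg x w : `|f (x, w)| <= normal_pdf (a 0 0) s x * gauss_rV s a' w.
  rewrite /f gauss_rV_cons normrM ger0_norm ?mulr_ge0 ?normal_pdf_ge0 ?gauss_rV_ge0//.
  by rewrite ler_piMr ?cos_max// mulr_ge0 ?normal_pdf_ge0 ?gauss_rV_ge0.
have ig1 := integrable_normal_pdf (a 0 0) s.
have ig2 := integrable_gauss_rV s a'.
rewrite Rintegral_cons//; last exact: (dominated_integrable_prod mf ig1 ig2 fg).
rewrite (dominated_Rintegral12 mf ig1 ig2 fg).
under eq_Rintegral => x _.
  rewrite (_ : (fun w => f (x, w)) = (fun w => normal_pdf (a 0 0) s x *
     (gauss_rV s a' w * cos ((c + t 0 0 * x) + dot t' w)))); last first.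
    by apply/funext => w; rewrite /f gauss_rV_cons dot_cons /= addrA mulrA.
  rewrite RintegralZl//; last first.
    apply: le_integrable ig2 => //.
      apply/measurable_EFinP; apply: measurable_funM; first exact: measurable_gauss_rV.
      apply: measurable_fun_cos.
      by apply: measurable_funD => //; exact: measurable_dotr.
    by move=> w _; rewrite lee_fin normrM ler_piMr// cos_max.
  rewrite IH (addrAC c) mulrCA; over.
rewrite RintegralZl//; last first.
  apply: le_integrable ig1 => //.
    apply/measurable_EFinP; apply: measurable_funM; first exact: measurable_normal_pdf.
    apply: measurable_fun_cos.
    by apply: measurable_funD => //; apply: measurable_funM.
  by move=> w _; rewrite lee_fin normrM ler_piMr// cos_max.
rewrite gauss_cos// mulrA -expRD !dot_recl -/a' -/t'; congr (expR _ * cos _).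
  by field.
by ring.
Qed.

Lemma gauss_rV0E n s (w : 'rV[R]_n) : s != 0 ->
  gauss_rV s 0 w = normal_peak s ^+ n * expR (- (dot w w / (s ^+ 2 *+ 2))).
Proof.
move=> s0; rewrite /gauss_rV.
under eq_bigr do rewrite normal_pdfE// mxE /normal_fun subr0 mulNr.
rewrite big_split/= prodr_const card_ord; congr (_ * _).
by rewrite -expR_sum /dot mulr_suml -sumrN.
Qed.

Lemma gauss_rV_center n s (a w : 'rV[R]_n) : s != 0 ->
  gauss_rV s a w = gauss_rV s 0 (w - a).
Proof.
move=> s0; apply: eq_bigr => i _.
by rewrite !normal_pdfE// !mxE /normal_fun subr0.
Qed.

End gauss_rV.

(** * Fourier inversion *)

(* Unlike [ge0_le_integral], no measurability is required: the integral of a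
   nonnegative function is a supremum over the simple functions below it. *)
Lemma ge0_le_integral_nomeas d (T : measurableType d) (R : realType)
  (mu : {measure set T -> \bar R}) (f g : T -> \bar R) :
  (forall x, 0 <= f x)%E -> (forall x, f x <= g x)%E ->
  (\int[mu]_x f x <= \int[mu]_x g x)%E.
Proof.
move=> f0 fg; rewrite !ge0_integralTE//; last by move=> x; exact: le_trans (fg x).
apply: le_ereal_sup => _ [h /= hf <-]; exists h => // x.
exact: le_trans (hf x) (fg x).
Qed.

Section complex_expi.
Context {R : realType}.
Local Open Scope complex_scope.

Lemma expi_mul_real (t c : R) : expi t * c%:C = (cos t * c) +i* (sin t * c).
Proof. by rewrite /expi; simpc. Qed.

Lemma Re_real_mul (c : R) (z : R[i]) : complex.Re (c%:C * z) = c * complex.Re z.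
Proof. by case: z => a b; simpc. Qed.

End complex_expi.

Lemma Re_cintegral (R : realType) m (g : 'rV[R]_m -> R[i]%C) :
  complex.Re (cintegral g) = \int[lebesgue_rV m]_w complex.Re (g w).
Proof. by []. Qed.

Section transforms.
Context {R : realType} {m : nat}.
Variable h : 'rV[R]_m -> R.
Hypothesis ih : (lebesgue_rV m).-integrable setT (EFin \o h).
Notation L := (lebesgue_rV m).

Let mh : measurable_fun setT h.
Proof. by apply/measurable_EFinP; exact: measurable_int ih. Qed.

Lemma integrable_bounded_mul (k : 'rV[R]_m -> R) :
  measurable_fun setT k -> (forall x, `|k x| <= 1) ->
  L.-integrable setT (EFin \o (fun x => k x * h x)).
Proof.
move=> mk k1; apply: le_integrable ih => //.
  by apply/measurable_EFinP; exact: measurable_funM.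
by move=> x _; rewrite lee_fin normrM ler_piMl.
Qed.

Definition cos_transform (w : 'rV[R]_m) := \int[L]_x (cos (dot w x) * h x).
Definition sin_transform (w : 'rV[R]_m) := \int[L]_x (sin (dot w x) * h x).

Let mcos w : measurable_fun setT (fun x : 'rV[R]_m => cos (dot w x)).
Proof. by apply: measurable_fun_cos; exact: measurable_dotr. Qed.

Let msin w : measurable_fun setT (fun x : 'rV[R]_m => sin (dot w x)).
Proof. by apply: measurable_fun_sin; exact: measurable_dotr. Qed.

Let icos w : L.-integrable setT (EFin \o (fun x => cos (dot w x) * h x)).
Proof. by apply: integrable_bounded_mul => // x; exact: cos_max. Qed.

Let isin w : L.-integrable setT (EFin \o (fun x => sin (dot w x) * h x)).
Proof. by apply: integrable_bounded_mul => // x; exact: sin_max. Qed.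

Lemma fourierE w :
  fourier h w = (cos_transform w +i* - sin_transform w)%C.
Proof.
rewrite /fourier /cintegral; congr (_ +i* _)%C.
  by apply: eq_Rintegral => x _; rewrite expi_mul_real /= cosN.
rewrite /sin_transform -mulN1r -RintegralZl//.
by apply: eq_Rintegral => x _; rewrite expi_mul_real /= sinN mulN1r mulNr.
Qed.

Lemma spread_hatE s2 w : spread_hat s2 h w =
  ((expR (- (s2 * dot w w / 2)) * cos_transform w) +i*
   (- (expR (- (s2 * dot w w / 2)) * sin_transform w)))%C.
Proof. by rewrite /spread_hat fourierE; simpc. Qed.

(** The real part of e^(i w.u) h~(w), the integrand of the inverse transform at [u]. *)
Definition wave u w := cos (dot w u) * cos_transform w + sin (dot w u) * sin_transform w.

Lemma spreadE s2 u : spread s2 h u = ((2 * pi) ^+ m)^-1 *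
  \int[L]_w (expR (- (s2 * dot w w / 2)) * wave u w).
Proof.
rewrite /spread /inv_fourier Re_real_mul Re_cintegral; congr (_ * _).
apply: eq_Rintegral => w _; rewrite spread_hatE /expi /=.
by rewrite /wave; ring.
Qed.

Lemma waveE u w : wave u w = \int[L]_x (cos (dot w (u - x)) * h x).
Proof.
rewrite /wave /cos_transform /sin_transform -!RintegralZl// -RintegralD//; last 2 first.
- exact: (integrableZl measurableT _ (icos w)).
- exact: (integrableZl measurableT _ (isin w)).
apply: eq_Rintegral => x _.
rewrite (_ : dot w (u - x) = dot w u - dot w x); last first.
  by rewrite /dot -sumrB; apply: eq_bigr => i _; rewrite !mxE mulrBr.
by rewrite cosB; ring.
Qed.

(* Fubini needs integrability in w as well: integrate against a Gaussian weight
   in w, then divide by it. *)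
Lemma measurable_param_Rintegral (k : 'rV[R]_m * 'rV[R]_m -> R) :
  measurable_fun setT k -> (forall z, `|k z| <= 1) ->
  measurable_fun setT (fun w => \int[L]_x (k (w, x) * h x)).
Proof.
move=> mk k1.
pose f (z : 'rV[R]_m * 'rV[R]_m) := gauss_rV 1 0 z.1 * (k z * h z.2).
have mf : measurable_fun setT f.
  apply: measurable_funM.
    exact: (measurableT_comp (measurable_gauss_rV 1 0) measurable_fst).
  by apply: measurable_funM => //; exact: measurableT_comp.
have fg w x : `|f (w, x)| <= gauss_rV 1 0 w * `|h x|.
  rewrite /f /= normrM (ger0_norm (gauss_rV_ge0 _ _ _)) ler_wpM2l ?gauss_rV_ge0//.
  by rewrite normrM ler_piMl.
have inh : L.-integrable setT (EFin \o (fun x => `|h x|)) by exact: integrable_norm.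
have int1 := dominated_integrable1 mf (integrable_gauss_rV 1 0) inh fg.
have m1 : measurable_fun setT (fun w => \int[L]_x f (w, x)).
  by apply/measurable_EFinP; exact: measurable_int int1.
have P0 : normal_peak (1 : R) ^+ m != 0 by rewrite expf_neq0// gt_eqF// normal_peak_gt0.
rewrite (_ : (fun w => _) = (fun w : 'rV[R]_m =>
    (normal_peak (1 : R) ^- m * expR (dot w w / 2)) * \int[L]_x f (w, x))).
  apply: measurable_funM => //; apply: measurable_funM => //.
  apply: measurableT_comp => //; apply: measurable_funM => //.
  have : measurable_fun setT (fun w : 'rV[R]_m => (w, w)) by exact: measurable_fun_pair.
  exact: (measurableT_comp (@measurable_dot R m)).
apply/funext => w; rewrite /f /= RintegralZl//; last first.
  by apply: integrable_bounded_mul => //; exact: measurable_fun_pair2 mk.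
rewrite mulrA gauss_rV0E// expr1n.
rewrite [X in _ = X * _](_ : _ = 1) ?mul1r// mulrACA mulVf// mul1r -expRD.
by rewrite -[1 *+ 2]/(2%:R) subrr expR0.
Qed.

Lemma measurable_cos_transform : measurable_fun setT cos_transform.
Proof.
apply: (@measurable_param_Rintegral (fun z => cos (dot z.1 z.2))).
  by apply: measurable_fun_cos; exact: measurable_dot.
by move=> z; exact: cos_max.
Qed.

Lemma measurable_sin_transform : measurable_fun setT sin_transform.
Proof.
apply: (@measurable_param_Rintegral (fun z => sin (dot z.1 z.2))).
  by apply: measurable_fun_sin; exact: measurable_dot.
by move=> z; exact: sin_max.
Qed.

Lemma measurable_weight s2 :
  measurable_fun setT (fun w : 'rV[R]_m => expR (- (s2 * dot w w / 2))).
Proof.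
apply: measurableT_comp => //; apply: measurableT_comp => //.
apply: measurable_funM => //; apply: measurable_funM => //.
have : measurable_fun setT (fun w : 'rV[R]_m => (w, w)) by exact: measurable_fun_pair.
exact: (measurableT_comp (@measurable_dot R m)).
Qed.

(** Each component is at most the modulus sqrt(a^2 + b^2), whose integral is finite by
    assumption. *)
Lemma finite_L1_integrable (a b : 'rV[R]_m -> R) :
  measurable_fun setT a -> measurable_fun setT b ->
  finite_L1 (fun w => a w +i* b w)%C ->
  L.-integrable setT (EFin \o a) /\ L.-integrable setT (EFin \o b).
Proof.
rewrite /finite_L1 /= => ma mb fin.
by split; apply/integrableP; (split; first exact/measurable_EFinP);
  apply: le_lt_trans fin; apply: ge0_le_integral_nomeas => // w;
  rewrite lee_fin -sqrtr_sqr ler_wsqrtr// ?lerDl ?lerDr sqr_ge0.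
Qed.

Lemma integrable_weighted_transforms s2 : spread_exists s2 h ->
  L.-integrable setT (EFin \o (fun w => expR (- (s2 * dot w w / 2)) * cos_transform w)) /\
  L.-integrable setT (EFin \o (fun w => expR (- (s2 * dot w w / 2)) * sin_transform w)).
Proof.
move=> ex.
have mc : measurable_fun setT (fun w => expR (- (s2 * dot w w / 2)) * cos_transform w).
  by apply: measurable_funM; [exact: measurable_weight|exact: measurable_cos_transform].
have ms : measurable_fun setT (fun w => - (expR (- (s2 * dot w w / 2)) * sin_transform w)).
  apply: measurableT_comp => //.
  by apply: measurable_funM; [exact: measurable_weight|exact: measurable_sin_transform].
have [|? isN] := finite_L1_integrable mc ms.
  by move: ex; rewrite /spread_exists (funext (spread_hatE s2)).
split => //; have := integrableN isN.
by apply: eq_integrable => // w _ /=; rewrite opprK.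
Qed.

Lemma integrable_transforms : finite_L1 (fourier h) ->
  L.-integrable setT (EFin \o cos_transform) /\
  L.-integrable setT (EFin \o sin_transform).
Proof.
move=> fin; have [|ic is_] := @integrable_weighted_transforms 0.
  rewrite /spread_exists (_ : spread_hat 0 h = fourier h)//; apply/funext => w.
  by rewrite spread_hatE fourierE mul0r mul0r oppr0 expR0 !mul1r.
by split; [apply: eq_integrable ic|apply: eq_integrable is_] => // w _ /=;
  rewrite mul0r mul0r oppr0 expR0 mul1r.
Qed.

Lemma measurable_wave u : measurable_fun setT (wave u).
Proof.
apply: measurable_funD; apply: measurable_funM.
- by apply: measurable_fun_cos; exact: measurable_dotl.
- exact: measurable_cos_transform.
- by apply: measurable_fun_sin; exact: measurable_dotl.
- exact: measurable_sin_transform.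
Qed.

Lemma wave_bound u w : `|wave u w| <= `|cos_transform w| + `|sin_transform w|.
Proof.
rewrite (le_trans (ler_normD _ _))// lerD// normrM ler_piMl//.
  exact: cos_max.
exact: sin_max.
Qed.

End transforms.

(** * Gaussian kernels as an approximate identity *)

Section normal_peak.
Context {R : realType}.

Lemma normal_peakE (s : R) : 0 < s -> normal_peak s = s^-1 * (Num.sqrt (pi *+ 2))^-1.
Proof.
move=> s0; rewrite /normal_peak -mulrnAr sqrtrM ?sqr_ge0// invfM.
by rewrite sqrtr_sqr gtr0_norm.
Qed.

(** The Fourier transform exchanges the widths [s] and [s^-1]; this product of peaks is the factor
    per coordinate that the constant of the inverse transform must match. *)
Lemma normal_peakV (s : R) : 0 < s -> normal_peak s^-1 * normal_peak s = (2 * pi)^-1.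
Proof.
move=> s0; rewrite !normal_peakE ?invr_gt0// mulrACA invrK mulfV ?gt_eqF// mul1r.
have E : (Num.sqrt (pi *+ 2 : R)) ^+ 2 = 2 * pi.
  by rewrite sqr_sqrtr ?mulr_natl// mulrn_wge0// pi_ge0.
by rewrite -invfM -expr2 E.
Qed.

(** Precisions add: 1/s^2 + 1 = (1 + s^2)/s^2 gives the new width, and the ratio of the two peaks
    gives the factor. *)
Lemma normal_pdf_mul_normal_fun (a s x : R) : 0 < s ->
  normal_pdf a s x * normal_fun a 1 x =
  (Num.sqrt (1 + s ^+ 2))^-1 * normal_pdf a (s / Num.sqrt (1 + s ^+ 2)) x.
Proof.
move=> s0; set q := Num.sqrt (1 + s ^+ 2).
have q0 : 0 < q by rewrite sqrtr_gt0 ltr_wpDr// sqr_ge0.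
have q2 : q ^+ 2 = 1 + s ^+ 2 by rewrite sqr_sqrtr// addr_ge0// sqr_ge0.
have sq0 : 0 < s / q by rewrite divr_gt0.
rewrite !normal_pdfE ?gt_eqF// !normal_peakE// -!mulrA.
rewrite (_ : normal_fun a s x * normal_fun a 1 x = normal_fun a (s / q) x); last first.
  rewrite /normal_fun -expRD; congr expR.
  have -> : (s / q) ^+ 2 = s ^+ 2 / (1 + s ^+ 2) by rewrite expr_div_n q2.
  have p0 : 1 + s ^+ 2 != 0 by rewrite -q2 expf_neq0// gt_eqF.
  by field; rewrite p0 gt_eqF.
by field; rewrite !gt_eqF// sqrtr_gt0 mulrn_wgt0// pi_gt0.
Qed.

Lemma integral_normal_pdf_mul_normal_fun (a s : R) : 0 < s ->
  (\int[lebesgue_measure]_x (normal_pdf a s x * normal_fun a 1 x)%:E =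
  ((Num.sqrt (1 + s ^+ 2))^-1)%:E)%E.
Proof.
move=> s0; under eq_integral do rewrite normal_pdf_mul_normal_fun// EFinM.
rewrite integralZl//; last exact: integrable_normal_pdf.
by rewrite integral_normal_pdf mule1.
Qed.

End normal_peak.

Section approximate_identity.
Context {R : realType} {m : nat}.
Variable h : 'rV[R]_m -> R.
Hypothesis ch : continuous h.
Variable B : R.
Hypothesis hB : forall x, `|h x| <= B.
Notation L := (lebesgue_rV m).

Let mh : measurable_fun setT h. Proof. exact: continuous_measurable_rV. Qed.

Lemma integrable_gauss_mul (s : R) (a : 'rV[R]_m) (k : 'rV[R]_m -> R) (D : R) :
  measurable_fun setT k -> (forall x, `|k x| <= D) ->
  L.-integrable setT (EFin \o (fun x => gauss_rV s a x * k x)).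
Proof.
move=> mk kD; have := integrableZl measurableT D (integrable_gauss_rV s a).
apply: le_integrable => //.
  apply/measurable_EFinP; apply: measurable_funM => //.
  exact: measurable_gauss_rV.
move=> x _; rewrite -EFinM lee_fin normrM mulrC.
have D0 : 0 <= D by exact: le_trans (kD x).
by rewrite normrM (ger0_norm D0) ler_wpM2r.
Qed.

(** Equal to 1 exactly at [u]. Being a product of Gaussians, it has an explicit mean under N(u, s^2
    I), which tends to 1 as s -> 0; this takes the place of Gaussian tail estimates. *)
Let bump (u x : 'rV[R]_m) : R := \prod_i normal_fun (u 0 i) 1 (x 0 i).

Let bump_ge0 u x : 0 <= bump u x.
Proof. by apply: prodr_ge0 => i _; exact: normal_fun_ge0. Qed.

Let normal_fun_le1 (a x : R) : normal_fun a 1 x <= 1.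
Proof.
by rewrite /normal_fun -expR0 ler_expR mulNr oppr_le0 divr_ge0 ?sqr_ge0.
Qed.

Let bump_le1 u x : bump u x <= 1.
Proof. by apply: prodr_ile1 => i _; rewrite normal_fun_ge0 normal_fun_le1. Qed.

Let measurable_bump u : measurable_fun setT (bump u).
Proof.
apply: (@measurable_prod_coord _ _ (fun i => normal_fun (u 0 i) 1)) => i.
exact: measurable_normal_fun.
Qed.

Let Rintegral_bump s u : 0 < s ->
  \int[L]_x (gauss_rV s u x * bump u x) = (Num.sqrt (1 + s ^+ 2)) ^- m.
Proof.
move=> s0; rewrite /Rintegral.
under eq_integral do rewrite /gauss_rV /bump -big_split/=.
rewrite (@integral_prod_rV _ _ (fun i y => normal_pdf (u 0 i) s y * normal_fun (u 0 i) 1 y)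
  (fun=> (Num.sqrt (1 + s ^+ 2))^-1)).
- by rewrite prodr_const card_ord /= exprVn.
- move=> i; apply: measurable_funM; first exact: measurable_normal_pdf.
  exact: measurable_normal_fun.
- by move=> i x; rewrite mulr_ge0 ?normal_pdf_ge0 ?normal_fun_ge0.
- by move=> i; exact: integral_normal_pdf_mul_normal_fun.
Qed.

(* Off a neighbourhood of u the bump stays away from 1, which turns continuity
   at u into a global bound. *)
Let continuity_bump u e : 0 < e -> exists2 M, 0 <= M &
  forall x, `|h x - h u| <= e + M * (1 - bump u x).
Proof.
move=> e0; have [P uP PA] : nbhs u [set x | `|h u - h x| < e].
  by have /cvgrPdist_lt/(_ _ e0) := @ch u.
have B0 : 0 <= B by exact: le_trans (hB 0).
(* A neighbourhood of a row vector is given entry by entry; finitely many entries admit a common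
   radius. *)
have [d d0 dP] : exists2 d : R, 0 < d & forall x : 'rV[R]_m, (forall j, `|u 0 j - x 0 j| < d) -> `|h u - h x| < e.
  have : \forall d \near (0 : R)^'+, forall j, forall y, `|u 0 j - y| < d -> P 0 j y.
    apply: filter_forall => j.
    have /nbhs_ballP[d /= d0 dP] := uP 0 j.
    near=> k => y uy; apply: dP; rewrite /ball/=; apply: lt_le_trans uy _.
    by near: k; exact: nbhs_right_le.
  move=> H; have [d [dH d0]] := filter_ex (filterI H (nbhs_right_gt (0 : R))).
  exists d => // x xd; apply: PA => i j; rewrite ord1; exact: dH.
(* If some coordinate is at distance at least [d] from that of [u], then [1 - bump u x >= k], and
   the witness [2 * B / k] raises this to the trivial bound [2 * B] on [|h x - h u|]. *)
pose k := 1 - expR (- (d ^+ 2 / 2)).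
have k0 : 0 < k.
  by rewrite subr_gt0 -expR0 ltr_expR oppr_lt0 divr_gt0// exprn_gt0.
exists (2 * B / k); first by rewrite !mulr_ge0// invr_ge0 ltW.
move=> x; have [xd|] := pselect (forall j, `|u 0 j - x 0 j| < d).
  rewrite distrC (le_trans (ltW (dP _ xd)))// lerDl mulr_ge0//.
    by rewrite !mulr_ge0// invr_ge0 ltW.
  by rewrite subr_ge0.
move=> /existsNP[j /negP]; rewrite -leNgt => dj.
have bk : k <= 1 - bump u x.
  rewrite lerD2l lerN2 /bump (bigD1 j)//=.
  rewrite (@le_trans _ _ (normal_fun (u 0 j) 1 (x 0 j)))//.
    rewrite ler_piMr ?normal_fun_ge0//.
    by apply: prodr_ile1 => i _; rewrite normal_fun_ge0 normal_fun_le1.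
  rewrite /normal_fun ler_expR mulNr lerN2 expr1n -[1 *+ 2]/(2%:R).
  rewrite ler_pM2r ?invr_gt0// -[leRHS]real_normK ?num_real// distrC.
  by rewrite ler_sqr ?nnegrE// ltW.
apply: (@le_trans _ _ (2 * B)).
  by rewrite (le_trans (ler_normB _ _))// mulr_natl mulr2n lerD.
rewrite (@le_trans _ _ (2 * B / k * k))//; first by rewrite divfK// gt_eqF.
have C0 : 0 <= 2 * B / k by rewrite !mulr_ge0// invr_ge0 ltW.
by rewrite (le_trans (ler_wpM2l C0 bk))// lerDr ltW.
Unshelve. all: end_near. Qed.

(** Averaging the bound of [continuity_bump] leaves [e / 2 + M * (1 - c)], where [c] is the mean of
    the bump and tends to 1. *)
Lemma gauss_approximate_identity u :
  \int[L]_x (gauss_rV n.+1%:R^-1 u x * h x) @[n --> \oo] --> h u.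
Proof.
apply/cvgrPdist_le => e e0; have e20 : 0 < e / 2 by lra.
have [M M0 HM] := continuity_bump u e20.
have sc : (Num.sqrt (1 + (n.+1%:R^-1) ^+ 2) ^- m : R) @[n --> \oo] --> (1 : R).
  have h1 : (1 + (n.+1%:R^-1) ^+ 2 : R) @[n --> \oo] --> (1 : R).
    rewrite -[X in _ --> X]addr0; apply: cvgD; first exact: cvg_cst.
    rewrite -[X in _ --> X](expr0n R 2) expr2; under eq_fun do rewrite expr2.
    by apply: cvgM; exact: cvg_harmonic.
  have h2 := cvg_comp _ _ h1 (@sqrt_continuous R 1).
  rewrite sqrtr1 in h2.
  have h3 : (Num.sqrt (1 + (n.+1%:R^-1) ^+ 2))^-1 @[n --> \oo] --> (1 : R).
    by rewrite -[X in _ --> X]invr1; apply: cvgV => //; exact: oner_neq0.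
  have h4 := @exprn_continuous R m 1; rewrite /continuous_at expr1n in h4.
  under eq_fun do rewrite -exprVn.
  exact: (cvg_comp _ _ h3 h4).
(* Division is by [M + 1] because [M] may be 0. *)
have M10 : 0 < M + 1 by lra.
have em0 : 0 < e / 2 / (M + 1) by rewrite divr_gt0.
have /cvgrPdist_le/(_ _ em0) := sc; apply: filterS => n.
set s : R := n.+1%:R^-1; have s0 : 0 < s by rewrite invr_gt0 ltr0n.
set c := Num.sqrt (1 + s ^+ 2) ^- m => hc.
have ih : L.-integrable setT (EFin \o (fun x => gauss_rV s u x * h x)).
  exact: integrable_gauss_mul hB.
have ig := integrable_gauss_rV s u.
have igu : L.-integrable setT (EFin \o (fun x => gauss_rV s u x * h u)).
  by apply: (@integrable_gauss_mul _ _ (cst (h u)) `|h u|).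
have E1 : h u = \int[L]_x (gauss_rV s u x * h u).
  by rewrite RintegralZr// Rintegral_gauss_rV mul1r.
have idf : L.-integrable setT (EFin \o (fun x => gauss_rV s u x * h u - gauss_rV s u x * h x)).
  by have := integrableB measurableT igu ih.
have ib : L.-integrable setT (EFin \o (fun x => gauss_rV s u x * bump u x)).
  apply: (@integrable_gauss_mul _ _ _ 1) => // x.
  by rewrite ger0_norm.
have iM : L.-integrable setT (EFin \o (fun x => M * (gauss_rV s u x * bump u x))).
  exact: (integrableZl measurableT M ib).
have iK : L.-integrable setT (EFin \o (fun x => (e / 2 + M) * gauss_rV s u x)).
  exact: (integrableZl measurableT (e / 2 + M) ig).
have iD : L.-integrable setT (EFin \o (fun x => (e / 2 + M) * gauss_rV s u x - M * (gauss_rV s u x * bump u x))).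
  by have := integrableB measurableT iK iM.
rewrite [X in `|X - _|]E1 -RintegralB//.
apply: le_trans (le_normr_Rintegral measurableT idf) _.
apply: (@le_trans _ _ (\int[L]_x ((e / 2 + M) * gauss_rV s u x - M * (gauss_rV s u x * bump u x)))).
  apply: le_Rintegral => //; first exact: integrable_norm.
  move=> x _; rewrite -mulrBr normrM (ger0_norm (gauss_rV_ge0 _ _ _)) distrC.
  rewrite (le_trans (ler_wpM2l (gauss_rV_ge0 _ _ _) (HM x)))//.
  by rewrite le_eqVlt; apply/orP; left; apply/eqP; ring.
rewrite RintegralB// !RintegralZl// Rintegral_gauss_rV Rintegral_bump// -/c mulr1.
have : M * `|1 - c| <= e / 2.
  apply: (@le_trans _ _ ((M + 1) * `|1 - c|)); first by rewrite ler_wpM2r//; lra.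
  by rewrite mulrC -ler_pdivlMr.
have := ler_wpM2l M0 (ler_norm (1 - c)); lra.
Qed.

End approximate_identity.

Section inversion.
Context {R : realType} {m : nat}.
Variable h : 'rV[R]_m -> R.
Hypothesis ch : continuous h.
Variable B : R.
Hypothesis hB : forall x, `|h x| <= B.
Notation L := (lebesgue_rV m).
Hypothesis ih : L.-integrable setT (EFin \o h).

Let mh : measurable_fun setT h. Proof. exact: continuous_measurable_rV. Qed.

Let dotB (w u x : 'rV[R]_m) : dot w (u - x) = dot w u - dot w x.
Proof. by rewrite /dot -sumrB; apply: eq_bigr => i _; rewrite !mxE mulrBr. Qed.

Let dot0 (w : 'rV[R]_m) : dot w 0 = 0.
Proof. by rewrite /dot big1// => i _; rewrite mxE mulr0. Qed.

Let dotNN (w : 'rV[R]_m) : dot (- w) (- w) = dot w w.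
Proof. by apply: eq_bigr => i _; rewrite !mxE mulrNN. Qed.

(** Up to normalization the weight is the density of N(0, s^-2 I), whose characteristic function at
    [u - x] is, again up to normalization, the density of N(u, s^2 I) at [x]. Fubini on [f] compares
    the two orders of integration: [x] first gives the wave, [w] first the characteristic
    function. *)
Lemma gauss_weighted_wave (s : R) u : 0 < s ->
  \int[L]_w (expR (- (s ^+ 2 * dot w w / 2)) * wave h u w) =
  (2 * pi) ^+ m * \int[L]_x (gauss_rV s u x * h x).
Proof.
move=> s0; have sV0 : 0 < s^-1 by rewrite invr_gt0.
have sn0 : s != 0 by rewrite gt_eqF.
pose f (z : 'rV[R]_m * 'rV[R]_m) :=
  gauss_rV s^-1 0 z.1 * (cos (dot z.1 (u - z.2)) * h z.2).
have mcos : measurable_fun setT (fun z : 'rV[R]_m * 'rV[R]_m => cos (dot z.1 (u - z.2))).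
  under eq_fun do rewrite dotB.
  apply: measurable_fun_cos; apply: measurable_funB; last exact: measurable_dot.
  exact: (measurableT_comp (measurable_dotl u) measurable_fst).
have mf : measurable_fun setT f.
  apply: measurable_funM.
    exact: (measurableT_comp (measurable_gauss_rV s^-1 0) measurable_fst).
  by apply: measurable_funM => //; exact: (measurableT_comp mh measurable_snd).
have fg w x : `|f (w, x)| <= gauss_rV s^-1 0 w * `|h x|.
  rewrite /f /= normrM (ger0_norm (gauss_rV_ge0 _ _ _)) ler_wpM2l ?gauss_rV_ge0//.
  by rewrite normrM ler_piMl// cos_max.
have inh : L.-integrable setT (EFin \o (fun x => `|h x|)) by exact: integrable_norm.
have ig := integrable_gauss_rV s^-1 (0 : 'rV[R]_m).
have := dominated_Fubini mf ig inh fg.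
have icos w : L.-integrable setT (EFin \o (fun x => cos (dot w (u - x)) * h x)).
  apply: integrable_bounded_mul => //; last by move=> x; exact: cos_max.
  exact: measurable_fun_pair2 mcos.
have -> : \int[L]_w \int[L]_x f (w, x) = normal_peak s^-1 ^+ m *
    \int[L]_w (expR (- (s ^+ 2 * dot w w / 2)) * wave h u w).
  have E w : \int[L]_x f (w, x) = gauss_rV s^-1 0 w * wave h u w.
    by rewrite /f /= RintegralZl// waveE.
  have E2 w : gauss_rV s^-1 0 w * wave h u w = normal_peak s^-1 ^+ m *
      (expR (- (s ^+ 2 * dot w w / 2)) * wave h u w).
    rewrite gauss_rV0E ?gt_eqF// -[LHS]mulrA; congr (_ * _); congr (_ * _).
    by congr expR; rewrite -mulr_natr; field.
  have P0 : normal_peak s^-1 ^+ m != 0.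
    by rewrite expf_neq0// gt_eqF// normal_peak_gt0// gt_eqF.
  rewrite -RintegralZl//; first by apply: eq_Rintegral => w _; rewrite E E2.
  (* The weighted wave is integrable because it is a constant multiple of the inner integral of
     [f]. *)
  have := integrableZl measurableT (normal_peak s^-1 ^- m) (dominated_integrable1 mf ig inh fg).
  apply: eq_integrable => // w _.
  by rewrite -EFinM; congr EFin; rewrite E E2 mulKf.
have -> : \int[L]_x \int[L]_w f (w, x) = normal_peak s ^- m *
    \int[L]_x (gauss_rV s u x * h x).
  rewrite -RintegralZl//; last exact: integrable_gauss_mul hB.
  apply: eq_Rintegral => x _.
  have -> : (fun w => f (w, x)) = (fun w => h x * (gauss_rV s^-1 0 w * cos (0 + dot (u - x) w))).
    by apply/funext => w; rewrite /f /= add0r dotC; ring.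
  rewrite RintegralZl//; last first.
    apply: (@integrable_gauss_mul _ _ _ _ _ 1); last by move=> w; exact: cos_max.
    by apply: measurable_fun_cos; apply: measurable_funD => //; exact: measurable_dotr.
  rewrite gauss_rV_cos// dot0 addr0 cos0 mulr1.
  have P0 : normal_peak s ^+ m != 0 by rewrite expf_neq0// gt_eqF// normal_peak_gt0.
  rewrite gauss_rV_center// gauss_rV0E// -(mulrA (normal_peak s ^+ m)) mulKf// mulrC; congr (expR _ * _).
  by rewrite -(dotNN (u - x)) opprB -mulr_natr; field.
move=> E; apply: (@mulfI _ (normal_peak s^-1 ^+ m)).
  by rewrite expf_neq0// gt_eqF// normal_peak_gt0// gt_eqF.
have K : normal_peak s^-1 ^+ m * (2 * pi) ^+ m * normal_peak s ^+ m = 1.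
  rewrite -!exprMn mulrAC normal_peakV// mulVf ?expr1n// mulf_neq0//.
  by rewrite gt_eqF// pi_gt0.
have P0 : normal_peak s ^+ m != 0 by rewrite expf_neq0// gt_eqF// normal_peak_gt0.
rewrite E mulrA; congr (_ * _).
by apply: (mulIf P0); rewrite mulVf// K.
Qed.

Hypothesis fin : finite_L1 (fourier h).

Let iA : L.-integrable setT (EFin \o cos_transform h).
Proof. by have [] := integrable_transforms ih fin. Qed.

Let iB : L.-integrable setT (EFin \o sin_transform h).
Proof. by have [] := integrable_transforms ih fin. Qed.

Let iAB : L.-integrable setT
  (EFin \o (fun w => `|cos_transform h w| + `|sin_transform h w|)).
Proof.
have := integrableD measurableT (integrable_norm iA) (integrable_norm iB).
exact.
Qed.

(** The damped integrals [I n] have two limits: the damping disappears by dominated convergence, as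
    the transforms are integrable, while [gauss_weighted_wave] rewrites [I n] as a Gaussian average
    of [h] that concentrates at [u]. *)
Lemma Rintegral_wave u : \int[L]_w wave h u w = (2 * pi) ^+ m * h u.
Proof.
have mw := measurable_wave ih u.
have iw : L.-integrable setT (EFin \o wave h u).
  apply: le_integrable iAB => //; first exact/measurable_EFinP.
  move=> w _; rewrite lee_fin (le_trans (wave_bound h u w))// ler_norm//.
pose s (n : nat) : R := n.+1%:R^-1.
have s0 n : 0 < s n by rewrite invr_gt0 ltr0n.
pose I n := \int[L]_w (expR (- (s n ^+ 2 * dot w w / 2)) * wave h u w).
have dww (w : 'rV[R]_m) : 0 <= dot w w by apply: sumr_ge0 => i _; rewrite -expr2 sqr_ge0.
have le1 n (w : 'rV[R]_m) : expR (- (s n ^+ 2 * dot w w / 2)) <= 1.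
  by rewrite -expR0 ler_expR oppr_le0 divr_ge0// mulr_ge0// sqr_ge0.
have s2c (c : R) : expR (- (s n ^+ 2 * c / 2)) @[n --> \oo] --> (1 : R).
  have h1 : (s n : R) @[n --> \oo] --> (0 : R) by exact: cvg_harmonic.
  have h2 : - (s n ^+ 2 * c / 2) @[n --> \oo] --> (0 : R).
    have -> : (fun n => - (s n ^+ 2 * c / 2)) = (fun n => s n * s n * (- (c / 2))).
      by apply/funext => n; ring.
    have := cvgM (cvgM h1 h1) (cvg_cst (- (c / 2))).
    by rewrite !mul0r; exact.
  have h3 := @continuous_expR R 0; rewrite /continuous_at expR0 in h3.
  exact: (cvg_comp _ _ h2 h3).
have c1 : I n @[n --> \oo] --> \int[L]_w wave h u w.
  apply: (@fine_cvg _ _ _ _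
    (fun n => \int[L]_w (expR (- (s n ^+ 2 * dot w w / 2)) * wave h u w)%:E)%E).
  rewrite fineK; last exact: integrable_fin_num.
  apply: (@dominated_cvg _ _ _ L _ measurableT
    (fun n w => (expR (- (s n ^+ 2 * dot w w / 2)) * wave h u w)%:E) _
    (fun w => (`|cos_transform h w| + `|sin_transform h w|)%:E)) => //.
  - move=> n; apply/measurable_EFinP; apply: measurable_funM => //.
    exact: measurable_weight.
  - move=> w _; apply: cvg_EFin; first exact: nearW.
    rewrite /comp/= -[X in _ --> X]mul1r.
    by apply: cvgM; [exact: s2c|exact: cvg_cst].
  - move=> n w _; rewrite lee_fin (le_trans _ (wave_bound h u w))//.
    by rewrite normrM ger0_norm ?expR_ge0// ler_piMl.
have c2 : I n @[n --> \oo] --> (2 * pi) ^+ m * h u.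
  rewrite /I; under eq_fun do rewrite gauss_weighted_wave//.
  by apply: cvgM; [exact: cvg_cst|exact: gauss_approximate_identity hB _].
exact: (cvg_unique _ c1 c2).
Qed.

Let twopi_neq0 : ((2 * pi : R) ^+ m) != 0.
Proof. by rewrite expf_neq0// mulf_neq0// gt_eqF// pi_gt0. Qed.

Lemma fourier_inversion u : spread 0 h u = h u.
Proof.
rewrite (spreadE ih); apply: (mulfI twopi_neq0); rewrite mulVKf//.
rewrite -Rintegral_wave; apply: eq_Rintegral => w _.
by rewrite mul0r mul0r oppr0 expR0 mul1r.
Qed.

Lemma gauss_mean_spread u : spread_exists (-1) h ->
  \int[L]_x (gauss_rV 1 u x * spread (-1) h x) = h u.
Proof.
move=> ex; have [ia ib] := integrable_weighted_transforms ih ex.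
set a := (fun w => _) in ia; set b := (fun w => _) in ib.
have aE w : a w = expR (- (-1 * dot w w / 2)) * cos_transform h w by [].
have bE w : b w = expR (- (-1 * dot w w / 2)) * sin_transform h w by [].
clearbody a b.
have ma : measurable_fun setT a by apply/measurable_EFinP; exact: measurable_int ia.
have mb : measurable_fun setT b by apply/measurable_EFinP; exact: measurable_int ib.
have iab : L.-integrable setT (EFin \o (fun w => `|a w| + `|b w|)).
  have := integrableD measurableT (integrable_norm ia) (integrable_norm ib).
  exact.
pose f (z : 'rV[R]_m * 'rV[R]_m) :=
  gauss_rV 1 u z.1 * (cos (dot z.2 z.1) * a z.2 + sin (dot z.2 z.1) * b z.2).
have mdot : measurable_fun setT (fun z : 'rV[R]_m * 'rV[R]_m => dot z.2 z.1).
  by under eq_fun do rewrite dotC; exact: measurable_dot.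
have mf : measurable_fun setT f.
  apply: measurable_funM.
    exact: (measurableT_comp (measurable_gauss_rV 1 u) measurable_fst).
  apply: measurable_funD; apply: measurable_funM.
  - exact: measurable_fun_cos.
  - exact: (measurableT_comp ma measurable_snd).
  - exact: measurable_fun_sin.
  - exact: (measurableT_comp mb measurable_snd).
have fg x w : `|f (x, w)| <= gauss_rV 1 u x * (`|a w| + `|b w|).
  rewrite /f /= normrM (ger0_norm (gauss_rV_ge0 _ _ _)) ler_wpM2l ?gauss_rV_ge0//.
  rewrite (le_trans (ler_normD _ _))// lerD// normrM ler_piMl//.
    exact: cos_max.
  exact: sin_max.
have ig := integrable_gauss_rV 1 u.
have Fub := dominated_Fubini mf ig iab fg.
have icos (x : 'rV[R]_m) : L.-integrable setT (EFin \o (fun w => cos (dot w x) * a w)).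
  apply: (@integrable_bounded_mul _ _ a ia (fun w => cos (dot w x))) => [|w]; last exact: cos_max.
  by apply: measurable_fun_cos; exact: measurable_dotl.
have isin (x : 'rV[R]_m) : L.-integrable setT (EFin \o (fun w => sin (dot w x) * b w)).
  apply: (@integrable_bounded_mul _ _ b ib (fun w => sin (dot w x))) => [|w]; last exact: sin_max.
  by apply: measurable_fun_sin; exact: measurable_dotl.
have isum (x : 'rV[R]_m) : L.-integrable setT
    (EFin \o (fun w => cos (dot w x) * a w + sin (dot w x) * b w)).
  by have := integrableD measurableT (icos x) (isin x); exact.
have E1 : \int[L]_x (gauss_rV 1 u x * spread (-1) h x) =
    ((2 * pi) ^+ m)^-1 * \int[L]_x \int[L]_w f (x, w).
  transitivity (\int[L]_x (((2 * pi) ^+ m)^-1 * \int[L]_w f (x, w))).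
    apply: eq_Rintegral => x _; rewrite (spreadE ih) mulrCA; congr (_ * _).
    transitivity (gauss_rV 1 u x * \int[L]_w (cos (dot w x) * a w + sin (dot w x) * b w)).
      by congr (_ * _); apply: eq_Rintegral => w _; rewrite /wave aE bE; ring.
    exact: (esym (RintegralZl _ measurableT (isum x))).
  exact: (RintegralZl _ measurableT (dominated_integrable1 mf ig iab fg)).
rewrite E1 Fub; apply: (mulfI twopi_neq0); rewrite mulVKf// -Rintegral_wave.
apply: eq_Rintegral => w _.
(* The sine is a cosine of phase [- (pi / 2)], so [gauss_rV_cos] covers both terms. *)
have -> : (fun x => f (x, w)) = (fun x => a w * (gauss_rV 1 u x * cos (0 + dot w x)) +
    b w * (gauss_rV 1 u x * cos (- (pi / 2) + dot w x))).
  apply/funext => x; rewrite /f /= add0r [in RHS]cosD cosN sinN cos_pihalf sin_pihalf.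
  by ring.
have icc c : L.-integrable setT (EFin \o (fun x => gauss_rV 1 u x * cos (c + dot w x))).
  apply: (@integrable_gauss_mul _ _ _ _ _ 1); last by move=> x; exact: cos_max.
  by apply: measurable_fun_cos; apply: measurable_funD => //; exact: measurable_dotr.
rewrite RintegralD//; last 2 first.
- exact: (integrableZl measurableT _ (icc 0)).
- exact: (integrableZl measurableT _ (icc (- (pi / 2)))).
rewrite !RintegralZl// !gauss_rV_cos// add0r cosD cosN sinN cos_pihalf sin_pihalf.
rewrite mul0r mulN1r opprK add0r /wave aE bE.
(* The decay of the characteristic function of N(u, I) cancels the growing multiplier of E_{-1}. *)
have eE : expR (- (1 ^+ 2 * dot w w / 2)) * expR (- (-1 * dot w w / 2)) = 1.
  rewrite -expRD -[RHS]expR0; congr expR; ring.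
set e1 := expR (- (1 ^+ 2 * _ / 2)) in eE *; set e2 := expR (- (-1 * _ / 2)) in eE *.
transitivity ((e1 * e2) * (cos (dot w u) * cos_transform h w + sin (dot w u) * sin_transform h w)).
  by ring.
by rewrite eE mul1r.
Qed.

End inversion.

(** * The normal tail and the rejection region *)

Section normal_tail.
Context {R : realType}.
Notation mu := (@lebesgue_measure R).
Implicit Types x y : R.

Lemma phi_gt0 x : 0 < phi x.
Proof. by rewrite /phi normal_pdfE ?oner_neq0// mulr_gt0 ?normal_peak_gt0 ?expR_gt0 ?oner_neq0. Qed.

Lemma continuous_phi : continuous (@phi R).
Proof. by apply: (@continuous_normal_pdf R 0 1); exact: oner_neq0. Qed.

(** Written as an integral so that the fundamental theorem differentiates it; [Phibar] follows by
    complement. *)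
Definition Phi x : R := \int[mu]_(t in `]-oo, x]) phi t.

Lemma Phi_itv x : (Phi x)%:E = normal_prob 0 1 `]-oo, x].
Proof. by rewrite /Phi /Rintegral fineK// ; exact: (fin_num_measure (normal_prob 0 1)). Qed.

Lemma PhibarE x : Phibar x = 1 - Phi x.
Proof.
apply: EFin_inj; rewrite EFinB Phi_itv /Phibar fineK; last exact: fin_num_measure.
by rewrite -probability_setC// setCitvl.
Qed.

Lemma is_derive_Phi x : is_derive x 1 Phi (phi x).
Proof.
have intf y : mu.-integrable `]-oo, y] (EFin \o phi).
  by apply: (@integrableS _ _ _ _ setT) => //; exact: integrable_normal_pdf.
have cphi := continuous_phi.
have [] := @continuous_FTC1 R phi -oo%O x (x + 1) _ (intf _) _ (cphi x).
- by rewrite ltrDl.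
- by rewrite ltNyr.
by move=> dF FE; apply: DeriveDef => //; rewrite -derive1E.
Qed.

Lemma is_derive_Phibar x : is_derive x 1 Phibar (- phi x).
Proof.
have -> : Phibar = cst 1 - Phi by apply/funext => y; rewrite PhibarE.
have dP := is_derive_Phi x.
by apply: is_derive_eq; rewrite sub0r.
Qed.

Lemma continuous_Phibar : continuous (@Phibar R).
Proof.
move=> x; apply: differentiable_continuous; apply/derivable1_diffP.
by have [] := is_derive_Phibar x.
Qed.

Lemma Phibar_MVT x y : x < y ->
  exists2 c, x < c < y & Phibar x - Phibar y = phi c * (y - x).
Proof.
move=> xy; have [c cxy E] := MVT xy (fun z _ => is_derive_Phibar z)
  (continuous_subspaceT continuous_Phibar).
exists c; first by rewrite in_itv/= in cxy.
by rewrite -opprB E mulNr opprK.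
Qed.

Lemma Phibar_decr x y : x < y -> Phibar y < Phibar x.
Proof.
move=> xy; have [c _ E] := Phibar_MVT xy.
by rewrite -subr_gt0 E mulr_gt0 ?phi_gt0 ?subr_gt0.
Qed.

Lemma Phibar_le x y : x <= y -> Phibar y <= Phibar x.
Proof. by rewrite le_eqVlt => /predU1P[->//|/Phibar_decr/ltW]. Qed.

Lemma Phibar_ge0 x : 0 <= Phibar x.
Proof. by rewrite /Phibar fine_ge0// measure_ge0. Qed.

Lemma Phibar_gt0 x : 0 < Phibar x.
Proof. by apply: le_lt_trans (Phibar_ge0 (x + 1)) _; apply: Phibar_decr; rewrite ltrDl. Qed.

Lemma Phi_ge0 x : 0 <= Phi x.
Proof. by apply: Rintegral_ge0 => y _; exact: normal_pdf_ge0. Qed.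

Lemma Phibar_le1 x : Phibar x <= 1.
Proof. by rewrite PhibarE lerBlDr lerDl Phi_ge0. Qed.

Lemma Phibar_cvg_y : Phibar n%:R @[n --> \oo] --> (0 : R).
Proof.
have H : normal_prob (0 : R) 1 (\bigcap_(n : nat) `]n%:R, +oo[%classic) = 0%:E.
  rewrite (_ : \bigcap_n _ = set0) ?measure0// -subset0 => x /= xn.
  have := xn (Num.bound `|x|) I; rewrite /= in_itv/= andbT.
  by rewrite ltNge (le_trans (ler_norm _))// ltW// archi_boundP.
apply: (@fine_cvg _ _ _ _ (fun n : nat => normal_prob (0 : R) 1 `]n%:R, +oo[%classic)).
rewrite -H; apply: (@nonincreasing_cvg_mu _ _ _ (normal_prob (0 : R) 1)) => //.
- by rewrite (le_lt_trans (probability_le1 _ _))// ltry.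
- exact: bigcapT_measurable.
- move=> n k nk; apply/subsetPset => x /=; rewrite !in_itv/= !andbT.
  by apply: le_lt_trans; rewrite ler_nat.
Qed.

Lemma Phi_cvg_Ny : Phi (- n%:R) @[n --> \oo] --> (0 : R).
Proof.
have H : normal_prob (0 : R) 1 (\bigcap_(n : nat) `]-oo, - n%:R]%classic) = 0%:E.
  rewrite (_ : \bigcap_n _ = set0) ?measure0// -subset0 => x /= xn.
  have := xn (Num.bound `|x|) I; rewrite /= in_itv/=.
  rewrite lerNr; have h := archi_boundP (normr_ge0 x).
  by rewrite leNgt (le_lt_trans _ h)// -normrN ler_norm.
apply: (@fine_cvg _ _ _ _ (fun n : nat => normal_prob (0 : R) 1 `]-oo, - n%:R]%classic)).
rewrite -H; apply: (@nonincreasing_cvg_mu _ _ _ (normal_prob (0 : R) 1)) => //.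
- by rewrite (le_lt_trans (probability_le1 _ _))// ltry.
- exact: bigcapT_measurable.
- move=> n k nk; apply/subsetPset => x /=; rewrite !in_itv/=.
  by move=> /le_trans; apply; rewrite lerN2 ler_nat.
Qed.

Lemma Phibar_small (e : R) : 0 < e -> exists x, Phibar x < e.
Proof.
move=> e0; have /cvgr0Pnorm_lt/(_ _ e0)[N _ /(_ N (leqnn _))/=] := Phibar_cvg_y.
by rewrite ger0_norm ?Phibar_ge0// => h; exists N%:R.
Qed.

Lemma Phibar_large (e : R) : e < 1 -> exists x, e < Phibar x.
Proof.
rewrite -subr_gt0 => e0.
have /cvgr0Pnorm_lt/(_ _ e0)[N _ /(_ N (leqnn _))/=] := Phi_cvg_Ny.
rewrite ger0_norm ?Phi_ge0// => h; exists (- N%:R); rewrite PhibarE.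
by rewrite ltrBrDl -ltrBrDr.
Qed.

(** [Phibar_inv] selects some preimage of [p], so it is enough that one exists, which the
    intermediate value theorem gives. *)
Lemma Phibar_invK (p : R) : 0 < p < 1 -> Phibar (Phibar_inv p) = p.
Proof.
move=> /andP[p0 p1]; have [b bp] := Phibar_small p0; have [a ap] := Phibar_large p1.
have ab : a <= b.
  by rewrite leNgt; apply/negP => /Phibar_decr; rewrite ltNge (ltW (lt_trans bp ap)).
have [||c _ cp] := @IVT R (@Phibar R) a b p ab.
- exact/continuous_subspaceT/continuous_Phibar.
- rewrite (min_idPr _) ?(max_idPl _) ?(ltW (lt_trans bp ap))//.
  by rewrite (ltW bp) (ltW ap).
by rewrite /Phibar_inv; case: xgetP => // /(_ c).
Qed.

Lemma phi_lipschitz : exists2 M : R, 0 <= M & forall x y, `|phi x - phi y| <= M * `|x - y|.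
Proof.
(* The peak value of [gauss_dom 0 1], which dominates |phi'(x)| = |x phi(x)|. *)
pose M := 2 * 1 * normal_peak (1 : R) / normal_peak (2 * 1) * normal_peak (2 * 1).
have dphi x : is_derive x 1 phi (- (x - 0) / 1 ^+ 2 * phi x).
  by apply: is_derive_normal_pdf; exact: ltr01.
have bd x : `|- (x - 0) / 1 ^+ 2 * phi x| <= M.
  rewrite expr1n divr1 mulNr normrN.
  apply: le_trans (normal_pdf_moment_bound 0 ltr01 x) _.
  rewrite /gauss_dom ler_wpM2l ?normal_pdf_ub ?mulr1 ?pnatr_eq0//.
  by rewrite !mulr_ge0 ?invr_ge0 ?normal_peak_ge0.
have M0 : 0 <= M by exact: le_trans (bd 0).
exists M => // x y.
wlog xy : x y / x <= y.
  move=> H; case: (leP x y) => [/H//|/ltW/H]; rewrite distrC => h.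
  by rewrite (distrC x).
have cphi := continuous_phi.
have [c _ E] := MVT_segment xy (fun z _ => dphi z) (continuous_subspaceT cphi).
by rewrite distrC E normrM (distrC x) ler_wpM2r.
Qed.

(** The mean value theorem produces [phi] at an intermediate point; moving it to the base point
    costs a Lipschitz factor, hence the square. In [step] the point [z] may be either endpoint,
    which covers both signs of [d]. *)
Lemma Phibar_taylor : exists2 M : R, 0 <= M &
  forall x d, `|Phibar (x + d) - (Phibar x - phi x * d)| <= M * d ^+ 2.
Proof.
have [M M0 lip] := phi_lipschitz; exists M => // x d.
have step a b : a < b -> forall z, a <= z <= b ->
    `|Phibar a - Phibar b - phi z * (b - a)| <= M * (b - a) ^+ 2.
  move=> ab z /andP[az zb]; have [c /andP[ac cb] ->] := Phibar_MVT ab.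
  have ba : `|b - a| = b - a by rewrite ger0_norm// subr_ge0 ltW.
  rewrite -mulrBl normrM ba expr2 mulrA.
  rewrite ler_pM2r ?subr_gt0// (le_trans (lip c z))// ler_wpM2l//.
  by rewrite ler_norml; apply/andP; split; lra.
case: (ltgtP d 0) => [d0|d0|->]; last first.
- by rewrite addr0 mulr0 subr0 subrr normr0 expr0n/= mulr0.
- have := step x (x + d) _ x; rewrite ltrDl lexx lerDl (ltW d0) => /(_ d0 isT).
  rewrite (_ : x + d - x = d); last by ring.
  rewrite -normrN; congr (`|_| <= _); ring.
- have := step (x + d) x _ x; rewrite gtrDl lexx gerDl (ltW d0) => /(_ d0 isT).
  rewrite (_ : x - (x + d) = - d); last by ring.
  by rewrite sqrrN; congr (`|_| <= _); ring.
Qed.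

(* For w >= c, phi(w + L) <= (a/2) phi(w) as soon as L is large, and the
   difference of the tails is monotone with limit 0. *)
Lemma Phibar_shift (c a : R) : 0 < a -> exists2 L : R, 0 < L &
  forall w, c <= w -> Phibar (w + L) < a * Phibar w.
Proof.
(* Aiming at [a / 2] leaves room for the strict inequality. [L] is chosen so that [L ^+ 2 / 2] is at
   least [|c| * L + |ln (a / 2)|], which bounds the exponent in phi(x + L) / phi(x) for x >= c. *)
move=> a0; have ah0 : 0 < a / 2 by lra.
pose L := 4 * `|c| + `|ln (a / 2)| + 4.
have L0 : 0 < L by rewrite /L; have := normr_ge0 c; have := normr_ge0 (ln (a/2)); lra.
exists L => // w cw.
pose D x := (a / 2) * Phibar x - Phibar (x + L).
have phiL x : c <= x -> phi (x + L) <= (a / 2) * phi x.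
  move=> cx; rewrite /phi normal_pdfE ?oner_neq0// mulrCA ler_pM2l ?normal_peak_gt0 ?oner_neq0//.
  rewrite /normal_fun -[a / 2 in leRHS]lnK ?posrE// -expRD ler_expR !subr0 expr1n.
  have h1 : - `|c| <= x by rewrite (le_trans _ cx)// lerNl -normrN ler_norm.
  have h2 : - `|ln (a / 2)| <= ln (a / 2) by rewrite lerNl -normrN ler_norm.
  have h3 := normr_ge0 c; have h4 := normr_ge0 (ln (a / 2)).
  have h5 : - (x * L) <= `|c| * L by rewrite -mulNr ler_pM2r//; lra.
  have h6 : `|ln (a / 2)| + `|c| * L <= L ^+ 2 / 2 by rewrite /L; nra.
  suff : - (x + L) ^+ 2 / 2%:R <= ln (a / 2) + - x ^+ 2 / 2%:R by [].
  nra.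
have dD x : is_derive x 1 D (- ((a / 2) * phi x - phi (x + L))).
  have d1 := is_derive_Phibar x; have d2 := is_derive_Phibar (x + L).
  have d3 : is_derive x 1 (Phibar \o (fun y => y + L)) (- phi (x + L) * 1).
    have d4 : is_derive x 1 (id + cst L : R -> R) 1.
      by apply: is_derive_eq; rewrite addr0.
    exact: (@is_derive1_comp _ Phibar (id + cst L : R -> R)).
  have -> : D = (a / 2) \*: Phibar - (Phibar \o (fun y => y + L)) by [].
  by apply: is_derive_eq; rewrite /GRing.scale/=; ring.
have cD : continuous D.
  move=> x; apply: differentiable_continuous; apply/derivable1_diffP.
  by have [] := dD x.
have Ddecr x y : c <= x -> x <= y -> D y <= D x.
  move=> cx xy; have [z zxy E] := MVT_segment xy (fun z _ => dD z) (continuous_subspaceT cD).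
  move: zxy; rewrite in_itv/= => /andP[xz zy].
  rewrite -subr_le0 E mulr_le0_ge0 ?subr_ge0// oppr_le0 subr_ge0 phiL//.
  exact: le_trans xz.
have D0 : 0 <= D w.
  rewrite leNgt; apply/negP => Dw.
  have Dw' : 0 < - D w by rewrite oppr_gt0.
  have [y yD] := Phibar_small Dw'.
  have : D (Num.max w y) <= D w by apply: Ddecr => //; rewrite le_max lexx.
  have : Phibar (Num.max w y + L) <= Phibar y.
    by apply: Phibar_le; rewrite (@le_trans _ _ (Num.max w y))// ?le_max ?lexx ?orbT// lerDl ltW.
  have := mulr_ge0 (ltW ah0) (Phibar_ge0 (Num.max w y)).
  have -> : D (Num.max w y) = (a / 2) * Phibar (Num.max w y) - Phibar (Num.max w y + L) by [].
  lra.
have := Phibar_gt0 w; move: D0; rewrite /D; nra.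
Qed.

End normal_tail.

Section rejection.
Context {R : realType}.
Variables (vs al : R).
Hypothesis al01 : 0 < al < 1.
Notation vr := (Phibar_inv (al * Phibar vs)).
Notation b := (al * (phi vs / phi vr)).

Let al0 : 0 < al. Proof. by case/andP: al01. Qed.
Let al1 : al < 1. Proof. by case/andP: al01. Qed.

Lemma Phibar_vr : Phibar vr = al * Phibar vs.
Proof.
apply: Phibar_invK; rewrite mulr_gt0 ?Phibar_gt0//=.
by rewrite (le_lt_trans _ al1)// ler_piMr ?Phibar_le1// ltW.
Qed.

Lemma phi_vr_slope : phi vr * b = al * phi vs.
Proof. by rewrite mulrCA (mulrC (phi vr)) divfK// gt_eqF// phi_gt0. Qed.

Let b0 : 0 <= b.
Proof. by rewrite mulr_ge0 ?ltW// divr_gt0// phi_gt0. Qed.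

(** Here [be] stands for w - vs, of order [t = |l|]. Constant and linear terms of the two expansions
    agree, so the sides differ by at most N t^2; moving the argument by Q t^2 changes the linear
    term by phi(vr) Q t^2 = N t^2, which decides the sign. *)
Lemma tail_ratio_expansion (P : R) : 0 <= P -> exists2 Q : R, 0 <= Q &
  forall t : R, Q * t <= 1 -> 0 <= t -> forall be, be ^+ 2 <= P * t ^+ 2 ->
  Phibar (vr + (b * be + Q * t ^+ 2)) <= al * Phibar (vs + be) /\
  al * Phibar (vs + be) <= Phibar (vr + (b * be - Q * t ^+ 2)).
Proof.
move=> P0; have := phi_vr_slope; have := b0.
move: (al * (phi vs / phi vr)) => c c0 cE; have [M M0 T] := @Phibar_taylor R.
(* The first summand bounds the Taylor error at [vr], the second the one at [vs], where [al < 1]. *)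
pose N := M * (2 * c ^+ 2 * P + 2) + M * P.
have f0 := @phi_gt0 R vr.
have N0 : 0 <= N by rewrite /N addr_ge0 ?mulr_ge0 ?addr_ge0 ?mulr_ge0 ?sqr_ge0.
exists (N / phi vr); first by rewrite divr_ge0// ltW.
set Q := N / phi vr; have Q0 : 0 <= Q by rewrite divr_ge0// ltW.
have QE : phi vr * Q = N by rewrite mulrC divfK// gt_eqF.
move=> t Qt t0 be beP.
have := T vr (c * be + Q * t ^+ 2); have := T vr (c * be - Q * t ^+ 2).
have := T vs be; rewrite Phibar_vr !ler_norml.
move=> /andP[h1 h2] /andP[h3 h4] /andP[h5 h6].
(* The condition [Q * t <= 1] keeps [Q] out of this bound, so that [N], and then [Q], can be fixed
   without circularity. *)
have Qt2 : (Q * t ^+ 2) ^+ 2 <= t ^+ 2.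
  rewrite expr2 (_ : Q * t ^+ 2 * (Q * t ^+ 2) = (Q * t) ^+ 2 * t ^+ 2); last by ring.
  rewrite ler_piMl ?sqr_ge0// expr_le1// mulr_ge0//.
have bb : (c * be) ^+ 2 <= c ^+ 2 * (P * t ^+ 2) by rewrite exprMn ler_wpM2l// sqr_ge0.
have s1 : (c * be + Q * t ^+ 2) ^+ 2 <= (2 * c ^+ 2 * P + 2) * t ^+ 2.
  by have := sqr_ge0 (c * be - Q * t ^+ 2); nra.
have s2 : (c * be - Q * t ^+ 2) ^+ 2 <= (2 * c ^+ 2 * P + 2) * t ^+ 2.
  by have := sqr_ge0 (c * be + Q * t ^+ 2); nra.
have m1 := ler_wpM2l M0 s1; have m2 := ler_wpM2l M0 s2; have m3 := ler_wpM2l M0 beP.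
have m4 : al * (M * be ^+ 2) <= M * (P * t ^+ 2).
  have MB : 0 <= M * be ^+ 2 by rewrite mulr_ge0// sqr_ge0.
  by rewrite (le_trans _ m3)// ler_piMl// ltW.
have E1 : phi vr * (c * be + Q * t ^+ 2) = al * phi vs * be + N * t ^+ 2.
  by rewrite mulrDr (mulrA _ c) cE (mulrA _ Q) QE.
have E2 : phi vr * (c * be - Q * t ^+ 2) = al * phi vs * be - N * t ^+ 2.
  by rewrite mulrBr (mulrA _ c) cE (mulrA _ Q) QE.
have k1 := ler_wpM2l (ltW al0) h1; have k2 := ler_wpM2l (ltW al0) h2.
have NE : N * t ^+ 2 = M * ((2 * c ^+ 2 * P + 2) * t ^+ 2) + M * (P * t ^+ 2).
  by rewrite /N; ring.
move: h3 h4 h5 h6; rewrite E1 E2 NE => h3 h4 h5 h6.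
set X := M * ((2 * c ^+ 2 * P + 2) * t ^+ 2) in h3 h4 h5 h6 m1 m2.
set Y := M * (P * t ^+ 2) in h3 h4 h5 h6 m4.
split; lra.
Qed.

(* Here x and w stand for psi_{-1}(H|y) and psi_{-1}(H|y) + psi_0(S|y), and the
   weight 1 + |v| is the one of [approx_y].  The expansion serves for |v| <= T;
   for v > T, x exceeds max(w, vs - 1) + L, and for v < - T, Phibar(x) > al. *)
Lemma rejection_boundary (K : R) : 0 <= K -> exists2 K' : R, 0 <= K' &
  exists2 d : R, 0 < d & forall l, `|l| < d -> forall v e g x w,
  `|e| <= K * `|l| -> `|g| <= K * `|l| ->
  `|x - (v + e)| <= K * (1 + `|v|) * l ^+ 2 ->
  `|w - (vs + e - g)| <= K * (1 + `|v|) * l ^+ 2 ->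
  (vr - (e + b * (g - e)) + K' * l ^+ 2 < v -> Phibar x < al * Phibar w) /\
  (v <= vr - (e + b * (g - e)) - K' * l ^+ 2 -> al * Phibar w <= Phibar x).
Proof.
move=> K0; have [L L0 HL] := Phibar_shift (vs - 1) al0.
have [x0 x0P] := Phibar_large al1.
have Nvs := normr_ge0 vs; have Nx0 := normr_ge0 x0; have Nvr := normr_ge0 vr.
have avs := ler_norm vs; have ax0 := ler_norm (- x0); have avr := ler_norm vr.
have avr' := ler_norm (- vr); have avs' := ler_norm (- vs).
rewrite !normrN in ax0 avr' avs'.
(* For [|v| > T] all these constants lie below |v|/2, whereas x is within |v|/8 + 1/4 of v and w
   within |v|/8 + 3/8 of vs once [l] is small. *)
pose T := 2 * (`|vs| + L + `|x0| + `|vr| + 2).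
have T0 : 0 < T by rewrite /T; lra.
pose N := K * (1 + T); have N0 : 0 <= N by rewrite mulr_ge0//; lra.
(* For [|v| <= T], |w - vs| is at most |e - g| + N t^2, hence at most (2 K + N) t. *)
have [Q Q0 HQ] := @tail_ratio_expansion ((2 * K + N) ^+ 2) (sqr_ge0 _).
move: b0 HQ; move: (al * (phi vs / phi vr)) => c c0 HQ.
have bN0 : 0 <= c * N by rewrite mulr_ge0.
have bK0 : 0 <= c * K by rewrite mulr_ge0.
(* [Q] comes from the expansion, [N] from the error of [x], and [c * N] from the error of [w] passed
   through the slope [c]. *)
exists (Q + N + c * N); first by lra.
(* The single condition [D * t < 1] yields every smallness condition used below: on [t], [K * t],
   [c * K * t] and [Q * t]. *)
pose D := 1 + 8 * K + K + 2 * (c * K) + Q.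
have D0 : 0 < D by rewrite /D; lra.
exists D^-1; first by rewrite invr_gt0.
move=> l; rewrite -[l ^+ 2]real_normK ?num_real//; set t := `|l|.
have t0 : 0 <= t by exact: normr_ge0.
rewrite -(ltr_pM2l D0) divff ?gt_eqF// => Dt.
have Kt0 := mulr_ge0 K0 t0; have bKt0 := mulr_ge0 bK0 t0; have Qt0 := mulr_ge0 Q0 t0.
have DtE : D * t = t + 8 * (K * t) + K * t + 2 * (c * K * t) + Q * t by rewrite /D; ring.
rewrite DtE in Dt.
have t1 : t <= 1 by lra.
have Kt : K * t <= 1 / 8 by lra.
have bKt : K * t + 2 * (c * K * t) <= 1 by lra.
have Qt : Q * t <= 1 by lra.
have t2 : t ^+ 2 <= t by rewrite expr2 ler_piMl.
have t20 : 0 <= t ^+ 2 by exact: sqr_ge0.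
have Kt2 : K * t ^+ 2 <= 1 / 8 by rewrite (le_trans _ Kt)// ler_wpM2l.
move=> v e g x w; rewrite !ler_norml => /andP[e1 e2] /andP[g1 g2].
set r := K * (1 + `|v|) * t ^+ 2.
have rE : r = (1 + `|v|) * (K * t ^+ 2) by rewrite /r; ring.
have v0 : 0 <= `|v| by exact: normr_ge0.
have r1 : r <= (1 + `|v|) / 8.
  by rewrite rE ler_wpM2l//; lra.
move=> /andP[x1 x2] /andP[w1 w2].
have bge : `|c * (g - e)| <= 2 * (c * K * t).
  rewrite normrM (ger0_norm c0) (_ : 2 * _ = c * (2 * (K * t))); last by ring.
  by rewrite ler_wpM2l// ler_norml; apply/andP; split; lra.
move: bge; rewrite ler_norml => /andP[bg1 bg2].
have K't : 0 <= (Q + N + c * N) * t ^+ 2 by rewrite mulr_ge0//; lra.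
have local : `|v| <= T ->
  (vr - (e + c * (g - e)) + (Q + N + c * N) * t ^+ 2 < v -> Phibar x < al * Phibar w) /\
  (v <= vr - (e + c * (g - e)) - (Q + N + c * N) * t ^+ 2 -> al * Phibar w <= Phibar x).
  move=> vT; have rN : r <= N * t ^+ 2.
    by rewrite ler_wpM2r// ler_wpM2l//; lra.
  have Nt : N * t ^+ 2 <= N * t by rewrite ler_wpM2l.
  have be2 : (w - vs) ^+ 2 <= (2 * K + N) ^+ 2 * t ^+ 2.
    rewrite -exprMn -[leLHS]real_normK ?num_real//.
    rewrite ler_sqr ?nnegrE// ?mulr_ge0//; last by lra.
    by rewrite ler_norml mulrDl -mulrA; apply/andP; split; lra.
  have [] := HQ t Qt t0 (w - vs) be2; rewrite (addrC vs) subrK => q1 q2.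
  have be : c * (w - vs - (e - g)) <= c * (N * t ^+ 2) by rewrite ler_wpM2l//; lra.
  have be' : c * (- (N * t ^+ 2)) <= c * (w - vs - (e - g)) by rewrite ler_wpM2l//; lra.
  have EK : (Q + N + c * N) * t ^+ 2 = Q * t ^+ 2 + N * t ^+ 2 + c * (N * t ^+ 2) by ring.
  have Eb2 : c * (w - vs - (e - g)) = c * (w - vs) + c * (g - e) by ring.
  rewrite mulrN in be'.
  rewrite EK; split => hv.
    apply: lt_le_trans q1; apply: Phibar_decr; lra.
  apply: (le_trans q2); apply: Phibar_le; lra.
have [vT|] := leP `|v| T; first exact: local.
rewrite lter_normr => /orP[vT|vT].
  have va : `|v| = v by rewrite ger0_norm//; lra.
  rewrite va in r1; split; last first.
    by move=> hv; exfalso; rewrite /T in vT; lra.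
  (* [w] may be very negative, since its error grows with [|v|]. Passing to [w'] can only decrease
     the tail and provides the lower bound that [HL] asks for. *)
  move=> _; set w' := Num.max w (vs - 1).
  have w'1 : vs - 1 <= w' by rewrite le_max lexx orbT.
  have w'2 : w <= w' by rewrite le_max lexx.
  have xw : w' + L <= x.
    by rewrite -lerBrDr ge_max; apply/andP; split; rewrite /T in vT; lra.
  apply: le_lt_trans (Phibar_le xw) _.
  apply: lt_le_trans (HL _ w'1) _.
  by rewrite ler_pM2l// Phibar_le.
have va : `|v| = - v by rewrite ler0_norm//; lra.
rewrite va in r1; split.
  by move=> hv; exfalso; rewrite /T in vT; lra.
(* Phibar(x0) exceeds [al], which is at least [al * Phibar w]. *)
move=> _; have xx0 : x <= x0 by rewrite /T in vT; lra.
apply: le_trans _ (Phibar_le xx0).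
by rewrite (le_trans _ (ltW x0P))// ler_piMr ?Phibar_le1// ltW.
Qed.

End rejection.

(** * Probabilities of nearly flat regions *)

Section gauss_prob.
Context {R : realType} {m : nat}.
Notation L := (lebesgue_rV m).
Notation mu := (@lebesgue_measure R).
Implicit Types (y : 'rV[R]_m * R) (f : 'rV[R]_m -> R).

Lemma gauss_pdfE y (z : 'rV[R]_m * R) :
  gauss_pdf 1 y z = gauss_rV 1 y.1 z.1 * normal_pdf y.2 1 z.2.
Proof. by []. Qed.

Lemma gauss_pdf_ge0 y (z : 'rV[R]_m * R) : 0 <= gauss_pdf 1 y z.
Proof. by rewrite gauss_pdfE mulr_ge0 ?gauss_rV_ge0 ?normal_pdf_ge0. Qed.

Lemma measurable_gauss_pdf y : measurable_fun setT (@gauss_pdf R m 1 y).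
Proof.
rewrite (_ : gauss_pdf 1 y = (fun z : 'rV[R]_m * R => gauss_rV 1 y.1 z.1 * normal_pdf y.2 1 z.2))//.
apply: measurable_funM.
  exact: (measurableT_comp (measurable_gauss_rV 1 y.1) measurable_fst).
exact: (measurableT_comp (measurable_normal_pdf y.2 1) measurable_snd).
Qed.

Lemma integral_gauss_pdf y :
  (\int[L \x mu]_z (gauss_pdf 1 y z)%:E = 1)%E.
Proof.
transitivity (\int[L]_u \int[mu]_v (gauss_rV 1 y.1 u * normal_pdf y.2 1 v)%:E)%E.
  apply: fubini_tonelli1.
    by apply/measurable_EFinP; exact: measurable_gauss_pdf.
  by move=> x; rewrite lee_fin gauss_pdf_ge0.
rewrite (eq_integral (fun u => (gauss_rV 1 y.1 u)%:E)).
  exact: integral_gauss_rV.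
move=> u _; under eq_integral do rewrite EFinM.
rewrite integralZl//; last exact: integrable_normal_pdf.
by rewrite integral_normal_pdf mule1.
Qed.

(** Valid for arbitrary sets because the comparison of nonnegative integrals is. Both integrals are
    at most 1, so [fine] preserves their order. *)
Lemma gauss_prob_le (A B : set ('rV[R]_m * R)) y : A `<=` B ->
  gauss_prob 1 A y <= gauss_prob 1 B y.
Proof.
move=> AB; rewrite /gauss_prob sqrtr1 /Rintegral.
have le1 (D : set ('rV[R]_m * R)) : (\int[L \x mu]_(z in D) (gauss_pdf 1 y z)%:E <= 1)%E.
  rewrite -(integral_gauss_pdf y) integral_mkcond.
  apply: ge0_le_integral_nomeas => z; rewrite patchE; case: ifPn => // _;
    by rewrite lee_fin gauss_pdf_ge0.
have fin (D : set ('rV[R]_m * R)) : (\int[L \x mu]_(z in D) (gauss_pdf 1 y z)%:E)%E \is a fin_num.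
  rewrite ge0_fin_numE; first exact: le_lt_trans (le1 D) (ltry _).
  by apply: integral_ge0 => z _; rewrite lee_fin gauss_pdf_ge0.
rewrite fine_le//; rewrite [leLHS]integral_mkcond [leRHS]integral_mkcond.
apply: ge0_le_integral_nomeas => z; rewrite !patchE.
  by case: ifPn => // _; rewrite lee_fin gauss_pdf_ge0.
case: ifPn => [/set_mem/AB/mem_set -> //|_].
by case: ifPn => // _; rewrite lee_fin gauss_pdf_ge0.
Qed.

Lemma integral_normal_pdf_tail (a c : R) :
  (\int[mu]_(v in `]c, +oo[) (normal_pdf a 1 v)%:E = (Phibar (c - a))%:E)%E.
Proof.
pose F (x : R) := x + a.
have dF (x : R) : is_derive x 1 F 1.
  have -> : F = id + cst a by [].
  by apply: is_derive_eq; rewrite addr0.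
have F'E : F^`()%classic = cst 1 by apply/funext => x; rewrite derive1E derive_val.
have cF (x : R) : {for x, continuous F}.
  by apply: differentiable_continuous; apply/derivable1_diffP.
rewrite integral_itv_obnd_cbnd; last first.
  by apply: measurable_funTS; apply/measurable_EFinP; exact: measurable_normal_pdf.
rewrite -[in LHS](subrK a c) -/(F (c - a)).
rewrite increasing_ge0_integration_by_substitutiony.
- transitivity (\int[mu]_(x in `[(c - a)%R, +oo[) (normal_pdf 0 1 x)%:E)%E.
    apply: eq_integral => x _; rewrite F'E; congr EFin.
    rewrite -[LHS]/(normal_pdf a 1 (F x) * 1) mulr1.
    by rewrite !normal_pdfE ?oner_neq0// /normal_fun subr0 addrK.
  rewrite -integral_itv_obnd_cbnd.
    by rewrite /Phibar fineK//; exact: fin_num_measure.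
  by apply: measurable_funTS; apply/measurable_EFinP; exact: measurable_normal_pdf.
- by move=> x y _ _ xy; rewrite /F ltrD2r.
- by move=> x _; rewrite F'E; exact: cvg_cst.
- by rewrite F'E; exact: is_cvg_cst.
- by rewrite F'E; exact: is_cvg_cst.
- split; first by move=> x _; have [] := dF x.
  by apply: cvg_at_right_filter; exact: cF.
- exact: cvg_addrr.
- by apply: continuous_subspaceT; apply: continuous_normal_pdf; exact: oner_neq0.
- by move=> x _; exact: normal_pdf_ge0.
Qed.

Lemma measurable_upper f c : measurable_fun setT f ->
  measurable (~` region f c : set ('rV[R]_m * R)).
Proof.
move=> mf.
have mg : measurable_fun setT (fun z : 'rV[R]_m * R => f z.1 + z.2).
  by apply: measurable_funD => //; exact: measurableT_comp.
rewrite [X in measurable X](_ : _ = (fun z : 'rV[R]_m * R => f z.1 + z.2) @^-1` `]c, +oo[).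
  by rewrite -[X in measurable X]setTI; exact: mg.
apply/seteqP; split => z /=; rewrite /region/= in_itv/= andbT.
  by move/negP; rewrite -ltNge ltrBlDl.
by move=> h; apply/negP; rewrite -ltNge ltrBlDl.
Qed.

Lemma gauss_prob_upper f c y : measurable_fun setT f ->
  gauss_prob 1 (~` region f c) y =
  \int[L]_u (gauss_rV 1 y.1 u * Phibar (c - f u - y.2)).
Proof.
move=> mf; rewrite /gauss_prob sqrtr1 /Rintegral; congr fine.
rewrite integral_mkcond.
transitivity (\int[L]_u \int[mu]_v
  ((fun z => (gauss_pdf 1 y z)%:E) \_ (~` region f c)) (u, v))%E.
  apply: fubini_tonelli1.
    have mE : measurable_fun setT (fun z : 'rV[R]_m * R => (gauss_pdf 1 y z)%:E).
      by apply/measurable_EFinP; exact: measurable_gauss_pdf.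
    exact: (measurable_restrictT _ (measurable_upper c mf)).1 (measurable_funTS mE).
  by move=> z; rewrite patchE; case: ifPn => // _; rewrite lee_fin gauss_pdf_ge0.
apply: eq_integral => u _.
rewrite (_ : (fun v => _) = ((fun v => (gauss_rV 1 y.1 u)%:E * (normal_pdf y.2 1 v)%:E)%E \_ `]c - f u, +oo[)).
  rewrite -integral_mkcond ge0_integralZl//.
  - by rewrite integral_normal_pdf_tail -EFinM.
  - apply/measurable_funTS/measurable_EFinP; exact: measurable_normal_pdf.
  - by move=> v _; rewrite lee_fin normal_pdf_ge0.
  - by rewrite lee_fin gauss_rV_ge0.
apply/funext => v; rewrite !patchE.
have -> : ((u, v) \in ~` region f c) = (v \in `]c - f u, +oo[%classic).
  apply/idP/idP; rewrite !inE /region/= in_itv/= andbT => h.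
    by rewrite ltNge; apply/negP.
  by apply/negP; rewrite -ltNge.
by case: ifPn => // _; rewrite gauss_pdfE EFinM.
Qed.

(** Taylor expansion at [c] with increment [- (f u + y.2)], averaged over [u]. Only the sum
    [f u + y.2] has to be small; on the boundary of H it is, since there [y.2] is minus a value of
    [h]. *)
Lemma gauss_prob_upper_expansion : exists2 M : R, 0 <= M &
  forall f c y D, continuous f -> (forall u, `|f u + y.2| <= D) ->
  `|gauss_prob 1 (~` region f c) y -
    (Phibar c + phi c * (\int[L]_u (gauss_rV 1 y.1 u * f u) + y.2))| <= M * D ^+ 2.
Proof.
have [M M0 T] := @Phibar_taylor R; exists M => // f c y D cf fD.
have mf := continuous_measurable_rV cf.
rewrite gauss_prob_upper//; set g := gauss_rV 1 y.1.
have ig : L.-integrable setT (EFin \o g) by exact: integrable_gauss_rV.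
have D0 : 0 <= D by exact: le_trans (fD 0).
have ifu : L.-integrable setT (EFin \o (fun u => g u * f u)).
  apply: (@integrable_gauss_mul _ _ _ _ _ (D + `|y.2|)) => // u.
  by rewrite -[f u](addrK y.2) (le_trans (ler_normB _ _))// lerD.
have iP : L.-integrable setT (EFin \o (fun u => g u * Phibar (c - f u - y.2))).
  apply: (@integrable_gauss_mul _ _ _ _ _ 1) => [|u].
    apply: measurableT_comp; first exact: (continuous_measurable_fun (@continuous_Phibar R)).
    by apply: measurable_funB => //; exact: measurable_funB.
  by rewrite ger0_norm ?Phibar_ge0// Phibar_le1.
pose k u := (Phibar c + phi c * y.2) * g u + phi c * (g u * f u).
have i1 : L.-integrable setT (EFin \o (fun u => (Phibar c + phi c * y.2) * g u)).
  exact: (integrableZl measurableT _ ig).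
have i2 : L.-integrable setT (EFin \o (fun u => phi c * (g u * f u))).
  exact: (integrableZl measurableT _ ifu).
have ik : L.-integrable setT (EFin \o k).
  by have := integrableD measurableT i1 i2; exact.
have kE : \int[L]_u k u = Phibar c + phi c * (\int[L]_u (g u * f u) + y.2).
  rewrite RintegralD// (RintegralZl _ measurableT ig) (RintegralZl _ measurableT ifu).
  by rewrite /g Rintegral_gauss_rV; ring.
rewrite -kE -RintegralB//.
have id_ : L.-integrable setT (EFin \o (fun u => g u * Phibar (c - f u - y.2) - k u)).
  by have := integrableB measurableT iP ik; exact.
apply: le_trans (le_normr_Rintegral measurableT id_) _.
rewrite -[leRHS]mulr1 -(Rintegral_gauss_rV 1 y.1) -(RintegralZl _ measurableT ig).
apply: le_Rintegral => //; first exact: integrable_norm.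
  exact: (integrableZl measurableT _ ig).
move=> u _; rewrite (_ : _ - _ = g u * (Phibar (c + - (f u + y.2)) - (Phibar c - phi c * - (f u + y.2)))).
  rewrite normrM (ger0_norm (gauss_rV_ge0 _ _ _)) mulrC ler_wpM2r ?gauss_rV_ge0//.
  apply: le_trans (T _ _) _; rewrite ler_wpM2l// sqrrN.
  by rewrite -[leLHS]real_normK ?num_real// ler_sqr// nnegrE.
rewrite /k (_ : c - f u - y.2 = c + - (f u + y.2)); last by ring.
by ring.
Qed.

(** The sets f(u) + v <= 0 and f(u) + v < 0 are closed and open, so a boundary point lies in the
    first but not in the second. *)
Lemma boundary_region f mu0 : continuous f ->
  boundary (region f 0) mu0 -> mu0.2 = - f mu0.1.
Proof.
move=> cf [].
have cg : continuous (fun z : 'rV[R]_m * R => f z.1 + z.2).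
  move=> z; apply: cvgD; last exact: cvg_snd.
  by apply: (cvg_comp fst f); [exact: cvg_fst|exact: cf].
have regE : region f 0 = (fun z : 'rV[R]_m * R => f z.1 + z.2) @^-1` [set t | t <= 0].
  apply/seteqP; split => z /=; rewrite /region/= sub0r => h.
    by rewrite addrC -lerBrDr sub0r.
  by move: h; rewrite addrC -lerBrDr sub0r.
have cl : closed (region f 0).
  by rewrite regE; apply: closed_comp => [z _|]; [exact: cg|exact: closed_le].
move/closure_id: cl => <- h1 h2.
apply/eqP; rewrite eq_le; apply/andP; split; first by move: h1; rewrite /region/= sub0r.
rewrite leNgt; apply/negP => h3; apply: h2.
have op : open ((fun z : 'rV[R]_m * R => f z.1 + z.2) @^-1` [set t | t < 0]).
  by apply: open_comp => [z _|]; [exact: cg|exact: open_lt].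
rewrite /interior; apply: (@filterS _ _ _ ((fun z : 'rV[R]_m * R => f z.1 + z.2) @^-1` [set t | t < 0])).
  by rewrite regE => z /= /ltW.
apply: open_nbhs_nbhs; split => //=.
by rewrite addrC -ltrBrDr sub0r.
Qed.

End gauss_prob.

(** * From nearly flat families to the level of the test *)

Lemma finite_L1_real (R : realType) m (h : 'rV[R]_m -> R) : continuous h ->
  finite_L1 (fun u => (h u)%:C)%C ->
  (lebesgue_rV m).-integrable setT (EFin \o h).
Proof.
move=> ch fin.
by have [] := @finite_L1_integrable R m h (cst 0) (continuous_measurable_rV ch)
  (measurable_cst _) fin.
Qed.

Lemma ratio_dist_le (R : realType) (PR PS al n q : R) :
  `|PR - al * PS| <= n -> 0 < q -> q <= PS -> `|PR / PS - al| <= n / q.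
Proof.
move=> hn q0 qPS; have PS0 : 0 < PS by exact: lt_le_trans qPS.
have n0 : 0 <= n by exact: le_trans hn.
rewrite (_ : PR / PS - al = (PR - al * PS) / PS); last by field; rewrite gt_eqF.
rewrite normrM (gtr0_norm (_ : 0 < PS^-1)) ?invr_gt0//.
by rewrite ler_pM// ?lef_pV2// invr_ge0 ltW.
Qed.

(** [P1] and [P2] are the probabilities of the enclosing sets, whose boundaries are shifted by [k]
    either way, and [d] is E_1 s - h at the boundary point. Since [fr * b = al * fs], the terms
    linear in [d] cancel, leaving the shift and the expansion errors. *)
Lemma prob_sandwich_bound (R : realType) (PR PS P1 P2 al Ph fr fs b d k e1 e2 : R) :
  0 <= al -> fr * b = al * fs -> P1 <= PR -> PR <= P2 ->
  `|P1 - (al * Ph + fr * (b * d - k))| <= e1 ->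
  `|P2 - (al * Ph + fr * (b * d + k))| <= e1 ->
  `|PS - (Ph + fs * d)| <= e2 ->
  `|PR - al * PS| <= fr * k + e1 + al * e2.
Proof.
move=> al0 E h1 h2.
rewrite mulrBr mulrDr (mulrA fr) E => H1 H2 H3.
have {}H3 : `|al * PS - (al * Ph + al * fs * d)| <= al * e2.
  by rewrite -mulrA -mulrDr -mulrBr normrM ger0_norm// ler_wpM2l.
move: H1 H2 H3; rewrite !ler_norml => /andP[a1 a2] /andP[b1 b2] /andP[c1 c2].
by apply/andP; split; lra.
Qed.

(** Keeps the selection probability, the denominator of the ratio, away from 0: [Ph] is its leading
    term Phibar(vs), and the total deviation is at most (p a + z) t. *)
Lemma half_le_of_dist_le (R : realType) (P Ph x e z t p a : R) :
  `|P - (Ph + x)| <= e -> e <= z * t -> `|x| <= p * a * t ->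
  (p * a + z) * t <= Ph / 2 -> Ph / 2 <= P.
Proof.
rewrite !ler_norml mulrDl => /andP[h1 _] h2 /andP[h3 _] h4.
move: (z * t) (p * a * t) h1 h2 h3 h4 => zt pt h1 h2 h3 h4; lra.
Qed.

Lemma gauss_mean_bound (R : realType) m (a : 'rV[R]_m) (k : 'rV[R]_m -> R) (D : R) :
  measurable_fun setT k -> (forall u, `|k u| <= D) ->
  `|\int[lebesgue_rV m]_u (gauss_rV 1 a u * k u)| <= D.
Proof.
move=> mk bk; have ig := integrable_gauss_rV 1 a.
have igk : (lebesgue_rV m).-integrable setT (EFin \o (fun u => gauss_rV 1 a u * k u)).
  exact: integrable_gauss_mul bk.
rewrite (le_trans (le_normr_Rintegral measurableT igk))//.
have iD : (lebesgue_rV m).-integrable setT (EFin \o (fun u => D * gauss_rV 1 a u)).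
  exact: (integrableZl measurableT _ ig).
have -> : D = \int[lebesgue_rV m]_u (D * gauss_rV 1 a u).
  by rewrite (RintegralZl _ measurableT ig) Rintegral_gauss_rV mulr1.
apply: (le_Rintegral measurableT _ iD).
  exact: (integrable_norm igk).
by move=> u _ /=; rewrite normrM ger0_norm ?gauss_rV_ge0// mulrC ler_wpM2r// gauss_rV_ge0.
Qed.

Lemma nearly_flat_inversion (R : realType) m (s : R -> 'rV[R]_m -> R) :
  nearly_flat s -> \forall l \near 0^', forall u, spread 0 (s l) u = s l u.
Proof.
move=> [sc [Ks sK] sL sF]; near=> l => u.
have cs : continuous (s l) by near: l.
have bs : forall u, `|s l u| <= Ks * `|l| by near: l.
have L1s : finite_L1 (fun u => (s l u)%:C)%C by near: l.
have fs : finite_L1 (fourier (s l)) by near: l.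
exact: (fourier_inversion cs bs (finite_L1_real cs L1s) fs).
Unshelve. all: end_near. Qed.

Lemma nearly_flat_mean (R : realType) m (h : R -> 'rV[R]_m -> R) :
  nearly_flat h -> (\forall l \near 0^', spread_exists (-1) (h l)) ->
  \forall l \near 0^', forall u,
    \int[lebesgue_rV m]_x (gauss_rV 1 u x * spread (-1) (h l) x) = h l u.
Proof.
move=> [hc [Kh hK] hL hF] ex; near=> l => u.
have ch : continuous (h l) by near: l.
have bh : forall u, `|h l u| <= Kh * `|l| by near: l.
have L1h : finite_L1 (fun u => (h l u)%:C)%C by near: l.
have exl : spread_exists (-1) (h l) by near: l.
have fh : finite_L1 (fourier (h l)) by near: l.
exact: (gauss_mean_spread ch bh (finite_L1_real ch L1h) fh).
Unshelve. all: end_near. Qed.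

Theorem theorem5p3 (R : realType) (m : nat) (h s : R -> 'rV[R]_m -> R)
    (vs alpha : R) (psiH psiS : R -> 'rV[R]_m * R -> R) :
  let H l := region (h l) 0 in
  let S l := ~` region (s l) vs in
  nearly_flat h -> nearly_flat s ->
  (\forall l \near 0^', spread_exists (-1) (h l)) ->
  nearly_flat (fun l => spread (-1) (h l)) ->
  extrapolates H (fun sigma2 l y => y.2 + spread sigma2 (h l) y.1)
    (-1) psiH ->
  extrapolates S (fun sigma2 l y => - y.2 + vs - spread sigma2 (s l) y.1)
    0 psiS ->
  0 < alpha < 1 ->
  let Rej l := [set y | pSI (psiH l) (psiS l) y < alpha] in
  let vr := Phibar_inv (alpha * Phibar vs) in
  let C := phi vs / phi vr in
  (forall r : R -> 'rV[R]_m -> R,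
     approx_u r (fun l u => spread (-1) (h l) u
                   + alpha * C * (s l u - spread (-1) (h l) u)) ->
     approx_region Rej (fun l => ~` region (r l) vr))
  /\ (exists K : R, \forall l \near 0^', forall mu, boundary (H l) mu ->
        `|gauss_prob 1 (Rej l) mu / gauss_prob 1 (S l) mu - alpha|
          <= K * l ^+ 2).
Proof.
move=> H S [hc [Kh hK] hL hF] [sc [Ks sK] sL sF] ex [Ec [KE EK] _ _] [_ [K1 psiHK]] [_ [K2 psiSK]] al01 Rej vr C.
have [al0 al1] := andP al01.
pose E l u := spread (-1) (h l) u.
pose b := alpha * C.
have b0 : 0 <= b by rewrite /b /C mulr_ge0 ?divr_ge0 ?ltW ?phi_gt0.
pose r0 l u := E l u + b * (s l u - E l u).
(* Absolute values, as the given constants have no prescribed sign; [K1 + K2] is the constant for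
   the error of the sum [psiH + psiS]. *)
pose K := `|Kh| + `|Ks| + `|KE| + `|K1| + `|K2|.
have [KhK [KsK [KEK [K1K K12K]]]] : Kh <= K /\ Ks <= K /\ KE <= K /\ K1 <= K /\ K1 + K2 <= K.
  have := ler_norm Kh; have := ler_norm Ks; have := ler_norm KE.
  have := ler_norm K1; have := ler_norm K2.
  have := normr_ge0 Kh; have := normr_ge0 Ks; have := normr_ge0 KE.
  have := normr_ge0 K1; have := normr_ge0 K2.
  by move=> *; rewrite /K; do !split; lra.
have K0 : 0 <= K by rewrite /K !addr_ge0.
have [K' K'0 [d d0 HR]] := rejection_boundary vs al01 K0.
have sE := nearly_flat_inversion (And4 sc (ex_intro _ Ks sK) sL sF).
have hE := nearly_flat_mean (And4 hc (ex_intro _ Kh hK) hL hF) ex.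
(* Both conclusions rest on this pointwise enclosure: the first absorbs the distance from [r] to
   [r0] into the constant, the second takes probabilities. *)
have region_rej : \forall l \near 0^', forall u v,
    (vr - r0 l u + K' * l ^+ 2 < v -> Rej l (u, v)) /\
    (v <= vr - r0 l u - K' * l ^+ 2 -> ~ Rej l (u, v)).
  near=> l => u v.
  have ld : `|l| < d by near: l; exact: dnbhs0_lt.
  have bs : forall u, `|s l u| <= Ks * `|l| by near: l.
  have bE : forall u, `|E l u| <= KE * `|l| by near: l.
  have sEl : forall u, spread 0 (s l) u = s l u by near: l.
  have HH : forall y, `|psiH l y - (y.2 + spread (-1) (h l) y.1)| <= K1 * (1 + `|y.2|) * l ^+ 2.
    by near: l.
  have HS : forall y, `|psiS l y - (- y.2 + vs - spread 0 (s l) y.1)| <= K2 * (1 + `|y.2|) * l ^+ 2.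
    by near: l.
  have rgt0 : 0 <= (1 + `|v|) * l ^+ 2 by rewrite mulr_ge0 ?sqr_ge0// addr_ge0.
  have [||||A B] := HR l ld v (E l u) (s l u) (psiH l (u, v)) (psiH l (u, v) + psiS l (u, v)).
  - by rewrite (le_trans (bE u))// ler_wpM2r//.
  - by rewrite (le_trans (bs u))// ler_wpM2r//.
  - rewrite (le_trans (HH (u, v)))// -!mulrA ler_wpM2r//.
  - apply: (@le_trans _ _ ((K1 + K2) * (1 + `|v|) * l ^+ 2)); last first.
      by rewrite -!mulrA ler_wpM2r//.
    have := HH (u, v); have := HS (u, v); rewrite /= sEl => hS hH.
    rewrite !mulrDl -/(E l u) in hS hH *.
    rewrite (_ : _ - _ = (psiH l (u, v) - (v + E l u)) + (psiS l (u, v) - (- v + vs - s l u))); last by ring.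
    by rewrite (le_trans (ler_normD _ _))// lerD.
  rewrite /Rej/= /pSI ltr_pdivrMr ?Phibar_gt0//; split => [hv|hv].
    apply: A; move: hv; rewrite /r0 /b /C; exact.
  by apply/negP; rewrite -leNgt; apply: B; move: hv; rewrite /r0 /b /C; exact.
split.
  move=> r [Kr rK]; exists (K' + `|Kr|); near=> l => u v.
  have HRej : forall u v, (vr - r0 l u + K' * l ^+ 2 < v -> Rej l (u, v)) /\
    (v <= vr - r0 l u - K' * l ^+ 2 -> ~ Rej l (u, v)) by near: l.
  have rl : forall u, `|r l u - r0 l u| <= Kr * l ^+ 2 by near: l.
  have [A B] := HRej u v.
  have kr : Kr * l ^+ 2 <= `|Kr| * l ^+ 2 by rewrite ler_wpM2r ?sqr_ge0// ler_norm.
  have := rl u; rewrite ler_norml => /andP[r1 r2].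
  rewrite mulrDl /region/=; split.
    by move=> /negP; rewrite -ltNge => h1; apply: A; lra.
  by move=> rej h1; apply: (B _ rej); lra.
have [M M0 GE] := @gauss_prob_upper_expansion R m.
(* For the shifted boundaries of the rejection region measured from that of H: [E] and [h]
   contribute [2 * K], the term [b * (s - E)] contributes [2 * b * K], and the shift [K']. *)
pose D1 := (2 + 2 * b) * K + K'.
have D10 : 0 <= D1 by rewrite /D1 addr_ge0// mulr_ge0// addr_ge0// mulr_ge0.
have q0 : 0 < Phibar vs / 2 by rewrite divr_gt0// Phibar_gt0.
(* The probability of S deviates from Phibar(vs) by at most [Z * |l|], from the linear term and the
   quadratic remainder. The later bound on [|l|] divides by [Z + 1], which is positive even if
   [Z = 0]. *)
pose Z := phi vs * (2 * K) + M * (2 * K) ^+ 2.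
have Z0 : 0 <= Z.
  by rewrite /Z addr_ge0// mulr_ge0// ?(ltW (phi_gt0 _)) ?sqr_ge0// mulr_ge0.
exists ((phi vr * K' + M * D1 ^+ 2 + alpha * (M * (2 * K) ^+ 2)) / (Phibar vs / 2)).
near=> l => mu bmu.
have HRej : forall u v, (vr - r0 l u + K' * l ^+ 2 < v -> Rej l (u, v)) /\
  (v <= vr - r0 l u - K' * l ^+ 2 -> ~ Rej l (u, v)) by near: l.
have ch : continuous (h l) by near: l.
have cs : continuous (s l) by near: l.
have cE : continuous (E l) by near: l.
have bh0 : forall u, `|h l u| <= Kh * `|l| by near: l.
have bs0 : forall u, `|s l u| <= Ks * `|l| by near: l.
have bE0 : forall u, `|E l u| <= KE * `|l| by near: l.
have meanEl : forall u, \int[lebesgue_rV m]_x (gauss_rV 1 u x * E l x) = h l u.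
  by near: l.
have l1 : `|l| <= 1 by near: l; exact: dnbhs0_le.
have lZ : `|l| <= (Phibar vs / 2) / (Z + 1) by near: l; apply: dnbhs0_le; rewrite divr_gt0//; lra.
have bh u : `|h l u| <= K * `|l|.
  by rewrite (le_trans (bh0 u))// ler_wpM2r//.
have bs u : `|s l u| <= K * `|l|.
  by rewrite (le_trans (bs0 u))// ler_wpM2r//.
have bE u : `|E l u| <= K * `|l|.
  by rewrite (le_trans (bE0 u))// ler_wpM2r//.
have t2 : `|l| ^+ 2 = l ^+ 2 by rewrite real_normK ?num_real.
have t2t : l ^+ 2 <= `|l| by rewrite -t2 expr2 ler_piMl.
have mu2 : mu.2 = - h l mu.1 by exact: boundary_region bmu.
set hm := h l mu.1 in mu2.
pose g := gauss_rV 1 mu.1.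
have meanE : \int[lebesgue_rV m]_u (g u * E l u) = hm by exact: meanEl.
have mE := continuous_measurable_rV cE.
have ms := continuous_measurable_rV cs.
have ig : (lebesgue_rV m).-integrable setT (EFin \o g) by exact: integrable_gauss_rV.
have igE : (lebesgue_rV m).-integrable setT (EFin \o (fun u => g u * E l u)).
  exact: integrable_gauss_mul bE.
have igs : (lebesgue_rV m).-integrable setT (EFin \o (fun u => g u * s l u)).
  exact: integrable_gauss_mul bs.
set sm := \int[lebesgue_rV m]_u (g u * s l u).
have meanr k : \int[lebesgue_rV m]_u (g u * (r0 l u + k)) = hm + b * (sm - hm) + k.
  have i1 : (lebesgue_rV m).-integrable setT (EFin \o (fun u => (1 - b) * (g u * E l u))).
    exact: (integrableZl measurableT _ igE).
  have i2 : (lebesgue_rV m).-integrable setT (EFin \o (fun u => b * (g u * s l u))).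
    exact: (integrableZl measurableT _ igs).
  have i3 : (lebesgue_rV m).-integrable setT (EFin \o (fun u => k * g u)).
    exact: (integrableZl measurableT _ ig).
  have i12 : (lebesgue_rV m).-integrable setT
      (EFin \o (fun u => (1 - b) * (g u * E l u) + b * (g u * s l u))).
    by have := integrableD measurableT i1 i2; exact.
  transitivity (\int[lebesgue_rV m]_u ((1 - b) * (g u * E l u) + b * (g u * s l u) + k * g u)).
    by apply: eq_Rintegral => u _; rewrite /r0; ring.
  rewrite (RintegralD measurableT i12 i3) (RintegralD measurableT i1 i2).
  rewrite (RintegralZl _ measurableT igE) (RintegralZl _ measurableT igs) (RintegralZl _ measurableT ig).
  by rewrite meanE /g Rintegral_gauss_rV -/sm; ring.
have cr k : continuous (fun u => r0 l u + k).
  move=> u; apply: (@continuousD _ _ _ (r0 l) (cst k)); last exact: cst_continuous.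
  apply: (@continuousD _ _ _ (E l) (fun u => b * (s l u - E l u))); first exact: cE.
  apply: (@continuousM _ _ (cst b) (fun u => s l u - E l u)); first exact: cst_continuous.
  by apply: (@continuousB _ _ _ (s l) (E l)); [exact: cs|exact: cE].
have br k u : `|k| <= K' * l ^+ 2 -> `|r0 l u + k + mu.2| <= D1 * `|l|.
  move=> hk; rewrite mu2.
  have hb : `|b * (s l u - E l u)| <= b * (K * `|l| + K * `|l|).
    by rewrite normrM (ger0_norm b0) ler_wpM2l// (le_trans (ler_normB _ _))// lerD.
  have hk' : `|k| <= K' * `|l| by rewrite (le_trans hk)// ler_wpM2l.
  rewrite (le_trans (ler_normB _ _))// (le_trans (lerD (ler_normD _ _) (bh mu.1)))//.
  rewrite (@le_trans _ _ ((K * `|l| + b * (K * `|l| + K * `|l|)) + K' * `|l| + K * `|l|))//.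
    by rewrite lerD2r lerD// (le_trans (ler_normD _ _))// lerD.
  by rewrite /D1 le_eqVlt; apply/orP; left; apply/eqP; ring.
have K'l : 0 <= K' * l ^+ 2 by rewrite mulr_ge0// sqr_ge0.
have N1 : `|K' * l ^+ 2| <= K' * l ^+ 2 by rewrite ger0_norm.
have N2 : `|- (K' * l ^+ 2)| <= K' * l ^+ 2 by rewrite normrN ger0_norm.
have P1 := GE _ vr mu (D1 * `|l|) (cr (- (K' * l ^+ 2))) (fun u => br _ u N2).
have P2 := GE _ vr mu (D1 * `|l|) (cr (K' * l ^+ 2)) (fun u => br _ u N1).
have bs2 u : `|s l u + mu.2| <= 2 * K * `|l|.
  rewrite mu2 (le_trans (ler_normB _ _))// (le_trans (lerD (bs u) (bh mu.1)))//.
  by rewrite le_eqVlt; apply/orP; left; apply/eqP; ring.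
have PS := GE _ vs mu (2 * K * `|l|) cs bs2.
have cancel_hm k : hm + b * (sm - hm) + k - hm = b * (sm - hm) + k by ring.
rewrite -/g meanr mu2 cancel_hm Phibar_vr // in P1.
rewrite -/g meanr mu2 cancel_hm Phibar_vr// in P2.
rewrite -/g -/sm mu2 in PS.
have Q1 : gauss_prob 1 (~` region (fun u => r0 l u + - (K' * l ^+ 2)) vr) mu <= gauss_prob 1 (Rej l) mu.
  apply: gauss_prob_le => -[u v]; rewrite /region/= => /negP; rewrite -ltNge => h1.
  by apply: (HRej u v).1; lra.
have Q2 : gauss_prob 1 (Rej l) mu <= gauss_prob 1 (~` region (fun u => r0 l u + K' * l ^+ 2) vr) mu.
  apply: gauss_prob_le => -[u v] rej; rewrite /region/= => h1.
  by apply: (HRej u v).2 rej; lra.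
have hsm : `|sm - hm| <= 2 * K * `|l|.
  rewrite (_ : 2 * K * `|l| = K * `|l| + K * `|l|); last by ring.
  rewrite (le_trans (ler_normB _ _))// lerD//; last exact: bh.
  exact: gauss_mean_bound.
have PS2 : Phibar vs / 2 <= gauss_prob 1 (S l) mu.
  have e2 : M * (2 * K * `|l|) ^+ 2 <= M * (2 * K) ^+ 2 * `|l|.
    by rewrite exprMn t2 mulrA ler_wpM2l// mulr_ge0// sqr_ge0.
  have e3 : `|phi vs * (sm - hm)| <= phi vs * (2 * K) * `|l|.
    by rewrite normrM (gtr0_norm (phi_gt0 vs)) -(mulrA (phi vs)) ler_wpM2l// ltW// phi_gt0.
  have e4 : Z * `|l| <= Phibar vs / 2.
    have Z1 : 0 < Z + 1 by rewrite ltr_wpDl.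
    rewrite ler_pdivlMr// mulrC in lZ.
    by apply: le_trans lZ; rewrite ler_wpM2r// lerDl.
  exact: (half_le_of_dist_le PS e2 e3 e4).
have PR := prob_sandwich_bound (ltW al0) (phi_vr_slope vs alpha) Q1 Q2 P1 P2 PS.
have := ratio_dist_le PR q0 PS2.
rewrite !exprMn t2 => /le_trans; apply.
rewrite le_eqVlt; apply/orP; left; apply/eqP; field.
by rewrite gt_eqF// Phibar_gt0.
Unshelve. all: end_near. Qed.
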